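(* Let $F(z)=zM+D+B^T(zI_n-A)^{-1}B\in\mathcal{PRO}_m$, where $n\ge 0$ is an integer, $M,D\in\mathbb{R}^{m\times m}$, $B\in\mathbb{R}^{n\times m}$, $A\in\mathbb{R}^{n\times n}$, $M\ge 0$, $A^T=-A$, $D^T=-D$ and $(A,B)$ is controllable. Decompose $B,D,M$ with respect to $\mathbb{R}^m=\mathcal{X}_1\oplus\mathcal{X}_2\oplus\mathcal{X}_3$ and define $K_1,\Xi,\widetilde{A},\widetilde{B}$ as in the context. Assume $\ker\widetilde{B}=\{0\}$, so that $\det F(z)\not\equiv 0$. Set $k=n+m_1-m_3$ and let $\Gamma\in\mathbb{R}^{(n+m_1)\times k}$ be an isometry with $\mathrm{Im}\,\Gamma\perp\mathrm{Im}\,\widetilde{B}$. Then a minimal Weierstrass descriptor realization of the inverse of $F$ is given by $$F(z)^{-1}=D_{\rm inv}^\circ +C_{\rm inv}^{\circ T} (zE_{\rm inv}^\circ -A_{\rm inv}^\circ)^{-1} B_{\rm inv}^\circ$$ with $$E_{\rm inv}^\circ=\begin{bmatrix} I_k&0&0\\ 0&0& I_{m_3}\\ 0&0&0\end{bmatrix},\quad A_{\rm inv}^\circ=\begin{bmatrix} A_{\rm inv}&0&0\\ 0&I_{m_3}&0\\ 0&0&I_{m_3}\end{bmatrix},\quad B_{\rm inv}^\circ=\begin{bmatrix} B_{\rm inv}\\ 0\\ -K_{\rm inv}\end{bmatrix},\quad C_{\rm inv}^\circ=\begin{bmatrix} B_{\rm inv}\\ K_{\rm inv}\\ 0\end{bmatrix},$$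 $$D_{\rm inv}^\circ=\begin{bmatrix} 0 & 0 & -M_1^{-1}D_{13}\Phi_{33}^{-1}\\ 0 & D_{22}^{-1} & -D_{22}^{-1}\Phi_{23}\Phi_{33}^{-1}\\ \Phi_{33}^{-1}D_{13}^TM_1^{-1} & -\Phi_{33}^{-1}\Phi_{23}^TD_{22}^{-1} & -\Phi_{33}^{-1}\,\Xi^T\widetilde{B}^T\widetilde{A}\widetilde{B}\,\Xi\,\Phi_{33}^{-1}\end{bmatrix},$$ where $$\Phi_{33}=B_3^TB_3+D_{13}^TM_1^{-1}D_{13},\qquad \Phi_{23}=B_2^TB_3+D_{12}^TM_1^{-1}D_{13},$$ $$A_{\rm inv}=\Gamma^T\widetilde{A}\,\Gamma,\qquad K_{\rm inv}=\begin{bmatrix}0&0&-\Xi\,\Phi_{33}^{-1/2}\end{bmatrix},$$ $$B_{\rm inv}=\Gamma^T\begin{bmatrix} 0 & B_2D_{22}^{-1} & (AB_3-B_1M_1^{-1}D_{13}-B_2D_{22}^{-1}\Phi_{23})\Phi_{33}^{-1}\\ K_1^{-T} & -K_1^{-T}D_{12}D_{22}^{-1} & -K_1^{-T}(B_1^TB_3-D_{11}M_1^{-1}D_{13}-D_{12}D_{22}^{-1}\Phi_{23})\Phi_{33}^{-1}\end{bmatrix},$$ and where $$\Xi^T\widetilde{B}^T\widetilde{A}\widetilde{B}\,\Xi=B_3^TAB_3-B_3^TB_1M_1^{-1}D_{13}+D_{13}^TM_1^{-1}B_1^TB_3-D_{13}^TM_1^{-1}D_{11}M_1^{-1}D_{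13}-\Phi_{23}^TD_{22}^{-1}\Phi_{23}.$$
   Context: For a square matrix $K$, $\mathrm{Re}(K)=\frac12(K+K^* )$ and $K\ge 0$ means positive semidefinite. $\mathcal{PRO}_m$ is the class of $m\times m$ rational matrix functions $F$ with $\mathrm{Re}(F(z))\ge 0$ for $\mathrm{Re}(z)>0$, $F(t)\in\mathbb{R}^{m\times m}$ for $t\in\mathbb{R}$ not a pole, and $-F(z)=F(-\overline z)^*$ for $z$ not a pole of $F$. (Every $F$ of the stated form lies in $\mathcal{PRO}_m$ and every element of $\mathcal{PRO}_m$ has this form.) $(A,B)$ is controllable if $[B\ AB\ \cdots\ A^{n-1}B]$ has rank $n$. Decomposition: $\mathbb{R}^m=\mathcal{X}_1\oplus\mathcal{X}_2\oplus\mathcal{X}_3$ (orthogonal), with $\mathcal{X}_1=(\ker M)^\perp$, $\mathcal{X}_3=\ker(P_{\ker M}D|_{\ker M})\subset\ker M$, and $\mathcal{X}_2$ the orthogonal complement of $\mathcal{X}_3$ in $\ker M$; here $P_{\ker M}$ is the orthogonal projection onto $\ker M$. With respect to this decomposition $$B=\begin{bmatrix}B_1&B_2&B_3\end{bmatrix},\quad D=\begin{bmatrix}D_{11}&D_{12}&D_{13}\\ -D_{12}^T&D_{22}&0\\ -D_{13}^T&0&0\end{bmatrix},\quad M=\begin{bmatrix}M_1&0&0\\ 0&0&0\\ 0&0&0\end{bmatrix},$$ with $M_1$ positive definite and $D_{22}$ invertible and skew-symmetric. Put $m_i=\dim\mathcal{X}_i$ ($m_2$ is even). Let $K_1:\mathcal{X}_1\to\mathbb{R}^{m_1}$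 and $\Xi:\mathcal{X}_3\to\mathbb{R}^{m_3}$ be linear maps with $K_1^TK_1=M_1$ and $\Xi^T\Xi=I_{\mathcal{X}_3}$ (so $K_1$ is invertible and $\Xi$ orthogonal); $K_1^{-T}=(K_1^{-1})^T$. Define $$\widetilde{A}=\begin{bmatrix}A-B_2D_{22}^{-1}B_2^T&(B_1+B_2D_{22}^{-1}D_{12}^T)K_1^{-1}\\ K_1^{-T}(-B_1^T+D_{12}D_{22}^{-1}B_2^T)&-K_1^{-T}(D_{11}+D_{12}D_{22}^{-1}D_{12}^T)K_1^{-1}\end{bmatrix},\quad \widetilde{B}=\begin{bmatrix}B_3\Xi^T\\ -K_1^{-T}D_{13}\Xi^T\end{bmatrix}.$$ All $3\times3$ block matrices acting on $\mathbb{R}^m$ (and the block columns of matrices with domain $\mathbb{R}^m$) are with respect to this decomposition; block rows with row spaces $\mathbb{R}^n,\mathbb{R}^{m_1},\mathbb{R}^{m_3},\mathbb{R}^k$ are as dictated by sizes. The condition $\det F(z)\not\equiv0$ is equivalent to $\ker\widetilde{B}=\{0\}$. A descriptor realization of a real rational matrix function $G$ is a representation $G(z)=D'+C'(zE'-A')^{-1}B'$ with real matrices, $E',A'$ square of the same size $N$ (the state space dimension) and $\det(zE'-A')\not\equiv0$. It is minimal if $N$ is as small as possible among all such representations of $G$. It is in Weierstrass form if, with respect to some orthogonal decomposition $\mathbb{R}^N=\mathbb{R}^{n_1}\oplus\mathbb{R}^{n_2}$, $E'=\begin{bmatrix}I_{n_1}&0\\ 0&N'\end{bmatrix}$ with $N'$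 nilpotent and $A'=\begin{bmatrix}A_1'&0\\ 0&I_{n_2}\end{bmatrix}$. *)

(* Defs.v *)
From HB Require Import structures.
From mathcomp Require Import all_boot all_order all_algebra.
From mathcomp Require Import classical_sets reals complex.

Set Implicit Arguments.
Unset Strict Implicit.
Unset Printing Implicit Defensive.

Import Order.TTheory GRing.Theory Num.Theory.
Local Open Scope ring_scope.
Local Open Scope sesquilinear_scope.

(* 3-block rows and columns; the sizes are nested as p1 + (p2 + p3). *)
Definition row3 (T : Type) (p q1 q2 q3 : nat)
    (X1 : 'M[T]_(p, q1)) (X2 : 'M[T]_(p, q2)) (X3 : 'M[T]_(p, q3)) :
  'M[T]_(p, q1 + (q2 + q3)) := row_mx X1 (row_mx X2 X3).

Definition col3 (T : Type) (p1 p2 p3 q : nat)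
    (X1 : 'M[T]_(p1, q)) (X2 : 'M[T]_(p2, q)) (X3 : 'M[T]_(p3, q)) :
  'M[T]_(p1 + (p2 + p3), q) := col_mx X1 (col_mx X2 X3).

Section RealMatrices.
Variable R : realType.

Definition psdmx (p : nat) (S : 'M[R]_p) : Prop :=
  S^T = S /\ forall x : 'cV[R]_p, 0 <= (x^T *m S *m x) 0 0.

(* The square root takes the junk value 0 when no psd square root exists. *)
Definition psd_sqrt (p : nat) (S : 'M[R]_p) : 'M[R]_p :=
  xget 0 [set Q : 'M[R]_p | psdmx Q /\ Q *m Q = S]%classic.

Definition ctrbmx (n m : nat) (A : 'M[R]_n) (B : 'M[R]_(n, m)) :=
  \mxrow_(i < n) (A ^+ i *m B).

Definition controllable (n m : nat) (A : 'M[R]_n) (B : 'M[R]_(n, m)) : Prop :=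
  \rank (ctrbmx A B) = n.

(* Matrices act on column vectors, whereas MathComp represents a subspace of
   R^p by the row space of a matrix: the row space of U stands for the set of
   the columns u^T with (u <= U)%MS. *)

(* {x | X x = 0} *)
Definition kerc (p q : nat) (X : 'M[R]_(p, q)) : 'M[R]_q := kermx X^T.

Definition orthc (p q : nat) (U : 'M[R]_(p, q)) : 'M[R]_q := kermx U^T.

(* The orthogonal projection onto U; proj_mx acts on rows, oproj on columns. *)
Definition oproj (p : nat) (U : 'M[R]_p) : 'M[R]_p := (proj_mx U (orthc U))^T.

Definition subX1 (m : nat) (M : 'M[R]_m) : 'M[R]_m := orthc (kerc M).

Definition subX3 (m : nat) (M D : 'M[R]_m) : 'M[R]_m :=
  (kerc M :&: kerc (oproj (kerc M) *m D))%MS.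

Definition subX2 (m : nat) (M D : 'M[R]_m) : 'M[R]_m :=
  (kerc M :&: orthc (subX3 M D))%MS.

(* The columns of V form an orthonormal basis of U; in particular d = dim U. *)
Definition orthonormal_basis (p d : nat) (U : 'M[R]_p) (V : 'M[R]_(p, d)) :
  Prop := V^T *m V = 1%:M /\ (V^T == U)%MS.

(* The columns of U are an orthonormal basis of R^N adapted to the
   decomposition (its two orthogonality conditions force n1 + n2 = N). *)
Definition weierstrass_form (N : nat) (E A : 'M[R]_N) : Prop :=
  exists (n1 n2 : nat) (U : 'M[R]_(N, n1 + n2)) (A1 : 'M[R]_n1) (J : 'M[R]_n2),
    [/\ U^T *m U = 1%:M /\ U *m U^T = 1%:M,
        exists j : nat, J ^+ j = 0,
        U^T *m E *m U = block_mx 1%:M 0 0 J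
      & U^T *m A *m U = block_mx A1 0 0 1%:M].

End RealMatrices.

(* C(z) *)
Notation ratfun R := {fraction {poly R[i]}}.

Section RationalMatrixFunctions.
Variable R : realType.

Definition zvar : ratfun R := FracField.tofrac 'X.

Definition const_ratfun (a : R) : ratfun R :=
  FracField.tofrac (real_complex R a)%:P.

Definition const_ratmx (p q : nat) (X : 'M[R]_(p, q)) : 'M[ratfun R]_(p, q) :=
  map_mx const_ratfun X.

(* f has no pole at z, and f(z) = w *)
Definition has_value (f : ratfun R) (z w : R[i]) : Prop :=
  exists p q : {poly R[i]},
    [/\ q.[z] != 0, f = FracField.tofrac p / FracField.tofrac q
      & w = p.[z] / q.[z]].

Definition has_valuemx (p q : nat) (F : 'M[ratfun R]_(p, q)) (z : R[i])
    (K : 'M[R[i]]_(p, q)) : Prop :=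
  forall i j, has_value (F i j) z (K i j).

Definition cpsdmx (p : nat) (K : 'M[R[i]]_p) : Prop :=
  K ^t* = K /\ forall x : 'cV[R[i]]_p, 0 <= (x ^t* *m K *m x) 0 0.

Definition remx (p : nat) (K : 'M[R[i]]_p) : 'M[R[i]]_p :=
  2^-1 *: (K + K ^t*).

Definition PRO (m : nat) (F : 'M[ratfun R]_m) : Prop :=
  [/\ forall z K, 0 < complex.Re z -> has_valuemx F z K -> cpsdmx (remx K),
      forall (t : R) K, has_valuemx F (real_complex R t) K -> K \is a realmx
    & forall z K, has_valuemx F z K ->
        exists2 L, has_valuemx F (- z^*) L & - K = L ^t*].

Definition descriptor_realization (m N : nat) (G : 'M[ratfun R]_m)
    (E A : 'M[R]_N) (B : 'M[R]_(N, m)) (C : 'M[R]_(m, N)) (D : 'M[R]_m) :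
  Prop :=
  let pencil := zvar *: const_ratmx E - const_ratmx A in
  \det pencil != 0 /\
  G = const_ratmx D + const_ratmx C *m invmx pencil *m const_ratmx B.

Definition minimal_descriptor_realization (m N : nat) (G : 'M[ratfun R]_m)
    (E A : 'M[R]_N) (B : 'M[R]_(N, m)) (C : 'M[R]_(m, N)) (D : 'M[R]_m) :
  Prop :=
  descriptor_realization G E A B C D /\
  forall (N' : nat) (E' A' : 'M[R]_N') (B' : 'M[R]_(N', m))
    (C' : 'M[R]_(m, N')) (D' : 'M[R]_m),
    descriptor_realization G E' A' B' C' D' -> (N <= N')%N.

(* z M + D + B^T (z I_n - A)^-1 B *)
Definition pro_function (m n : nat) (M D : 'M[R]_m) (B : 'M[R]_(n, m))
    (A : 'M[R]_n) : 'M[ratfun R]_m :=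
  zvar *: const_ratmx M + const_ratmx D
  + const_ratmx B^T *m invmx (zvar%:M - const_ratmx A) *m const_ratmx B.

End RationalMatrixFunctions.

(* Main.v *)
From HB Require Import structures.
Require Import Defs.
From mathcomp Require Import all_boot all_order all_algebra.
From mathcomp Require Import classical_sets reals complex.
From mathcomp Require Import ring.
Set Implicit Arguments.
Unset Strict Implicit.
Unset Printing Implicit Defensive.
Import Order.TTheory GRing.Theory Num.Theory.
Local Open Scope ring_scope.

(** Since B^T (z - A)^-1 B is a Schur complement, inverting F means solving the
    linear system
      (z - A) x - B u = 0,     B^T x + (z M + D) u = f
    for u. In the coordinates u = V1 u1 + V2 u2 + V3 u3 the second line splits
    into three. The one indexed by X2 contains no z and its coefficient D22 is
    invertible, so u2 can be eliminated; the one indexed by X1 has leading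
    coefficient z M1 with M1 = K1^T K1, so y = K1 u1 joins x as a state
    variable. What is left, for xi = (x, y), is the bordered system
      (z - S) xi - W u3 = a,     W^T xi = f3
    with S the skew-symmetric matrix A~ and W = B~ Xi. Splitting xi orthogonally
    along Im W and its complement Im Gam, the constraint fixes the component in
    Im W, and the component Gam v solves an ordinary resolvent equation with
    matrix Gam^T S Gam; reading off u3 then costs one factor z, which produces
    the polynomial term z V3 Phi33^-1 V3^T. This is the content of
    [bordered_solution], [eliminated_system] and [pro_function_inverse].

    Controllability of (A, B) is used in the form [reachable]: no nonzero
    A-stable space of row vectors kills B. A stable space killing B_inv lifts
    through Gam to a space on which the y-components, and the products with all
    B Vi, vanish, and which is therefore A-stable and kills B
    ([reachable_inverse]). As A_inv is skew, observability follows.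

    For minimality, expand a descriptor realization at a real regular point s:
    with T = (s E - A)^-1 E its transfer function determines the moments
    C T^j (s E - A)^-1 B for every j > 0, but not for j = 0 since the
    feedthrough is free ([realizations_moments]). For the realization at hand
    T = diag (T1, -J) with T1 invertible and J^2 = 0, and it is reachable and
    observable. Hence for any competitor T' there are matrices O, Q with
    O T'^j Q = T^j for all j > 0, and a Gram-type matrix built from O, O T', Q,
    T' Q, which factors through the competitor's state space, has a submatrix of
    the form diag (T1^2, G) where G = [0 J; J *] up to sign. Its rank is at least
    k + 2 rank J whatever the unknown block is ([dimension_bound]); here
    rank J = m3, so that k + 2 m3 states are necessary. *)

(** * Matrix preliminaries *)

Lemma mxaddE (V : zmodType) p q (X Y : 'M[V]_(p, q)) i j :
  (X + Y) i j = X i j + Y i j.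
Proof. by rewrite mxE. Qed.

Lemma mxoppE (V : zmodType) p q (X : 'M[V]_(p, q)) i j : (- X) i j = - X i j.
Proof. by rewrite mxE. Qed.

Lemma mxscaleE (F : pzRingType) p q (a : F) (X : 'M[F]_(p, q)) i j :
  (a *: X) i j = a * X i j.
Proof. by rewrite mxE. Qed.

Lemma trmxN (V : zmodType) p q (X : 'M[V]_(p, q)) : (- X)^T = - X^T.
Proof. exact: raddfN. Qed.

Lemma trmxD (V : zmodType) p q (X Y : 'M[V]_(p, q)) : (X + Y)^T = X^T + Y^T.
Proof. exact: raddfD. Qed.

Lemma trmxB (V : zmodType) p q (X Y : 'M[V]_(p, q)) : (X - Y)^T = X^T - Y^T.
Proof. exact: raddfB. Qed.

Lemma mxzeroE (V : nmodType) p q i j : (0 : 'M[V]_(p, q)) i j = 0.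
Proof. by rewrite mxE. Qed.

(** Matrix identities that hold by linearity alone are checked entrywise;
    products of matrices, which [mxE] would expand into sums, stay atomic. *)
Ltac mxlinear :=
  apply/matrixP => ? ?; rewrite !(mxaddE, mxoppE, mxscaleE, mxzeroE); ring.

Lemma unitmx_row0 (F : fieldType) (n : nat) (S : 'M[F]_n) :
  (forall x : 'rV_n, x *m S = 0 -> x = 0) -> S \in unitmx.
Proof.
move=> h; rewrite -row_free_unit -kermx_eq0; apply/eqP/row_matrixP => i.
by rewrite row0; apply: h; rewrite -row_mul mulmx_ker row0.
Qed.

Lemma invmx_eq (F : fieldType) (n : nat) (X Y : 'M[F]_n) :
  X *m Y = 1%:M -> invmx X = Y.
Proof.
move=> XY; have [Xu _] := mulmx1_unit XY.
by rewrite -[LHS]mulmx1 -XY mulmxA mulVmx // mul1mx.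
Qed.

Lemma exp_block_diag (F : fieldType) (k r : nat) (A : 'M[F]_k) (B : 'M[F]_r)
    (j : nat) : block_mx A 0 0 B ^+ j = block_mx (A ^+ j) 0 0 (B ^+ j).
Proof.
elim: j => [|j IH]; first by rewrite !expr0 -scalar_mx_block.
rewrite !exprS IH -!mulmxE mulmx_block.
by rewrite !(mulmx0, mul0mx, addr0, add0r).
Qed.

(** The columns of Gam and W together form a basis, with dual basis the rows
    of Gam^T and Phii W^T; for a square matrix a one-sided inverse is
    two-sided. *)
Lemma complementary_projections (F : fieldType) (N k p : nat)
    (Gam : 'M[F]_(N, k)) (W : 'M[F]_(N, p)) (Phii : 'M[F]_p) :
  (k + p)%N = N -> Gam^T *m Gam = 1%:M -> Gam^T *m W = 0 ->
  W^T *m W *m Phii = 1%:M -> Gam *m Gam^T + W *m Phii *m W^T = 1%:M.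
Proof.
move=> kpN GG GW WW; pose X := row_mx Gam W.
pose Y := col_mx Gam^T (Phii *m W^T).
have PW : Phii *m (W^T *m W) = 1%:M by apply: mulmx1C.
have WG : W^T *m Gam = 0 by rewrite -[Gam]trmxK -trmx_mul GW trmx0.
have YX : Y *m X = 1%:M.
  rewrite mul_col_row GG GW -!mulmxA WG PW mulmx0.
  by rewrite -scalar_mx_block.
have XY : X *m Y = 1%:M.
  have Xf : row_free X.
    rewrite /row_free eqn_leq rank_leq_row.
    by apply: leq_trans (mxrankM_maxr Y X); rewrite YX mxrank1 kpN.
  case/row_freeP: Xf => Z XZ.
  by rewrite -[Y]mulmx1 -XZ (mulmxA Y) YX mul1mx.
by rewrite -XY mul_row_col mulmxA.
Qed.

Lemma row3_mul_tr (F : comNzRingType) (p q q1 q2 q3 : nat)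
    (X1 : 'M[F]_(p, q1)) (X2 : 'M[F]_(p, q2)) (X3 : 'M[F]_(p, q3))
    (V1 : 'M[F]_(q, q1)) (V2 : 'M[F]_(q, q2)) (V3 : 'M[F]_(q, q3)) :
  row3 X1 X2 X3 *m (row3 V1 V2 V3)^T
    = X1 *m V1^T + X2 *m V2^T + X3 *m V3^T.
Proof. by rewrite /row3 !tr_row_mx !mul_row_col addrA. Qed.

Lemma row3_mul_col3 (F : comNzRingType) (p q q1 q2 q3 : nat)
    (V1 : 'M[F]_(q, q1)) (V2 : 'M[F]_(q, q2)) (V3 : 'M[F]_(q, q3))
    (X1 : 'M[F]_(q1, p)) (X2 : 'M[F]_(q2, p)) (X3 : 'M[F]_(q3, p)) :
  row3 V1 V2 V3 *m col3 X1 X2 X3 = V1 *m X1 + V2 *m X2 + V3 *m X3.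
Proof. by rewrite /row3 /col3 !mul_row_col addrA. Qed.

Lemma col3_mul (F : comNzRingType) (p q q1 q2 q3 : nat)
    (X1 : 'M[F]_(q1, p)) (X2 : 'M[F]_(q2, p)) (X3 : 'M[F]_(q3, p))
    (Y : 'M[F]_(p, q)) :
  col3 X1 X2 X3 *m Y = col3 (X1 *m Y) (X2 *m Y) (X3 *m Y).
Proof. by rewrite /col3 !mul_col_mx. Qed.

Lemma col3_row3_diag (F : comNzRingType) (p q r : nat) (X : 'M[F]_p)
    (Y11 : 'M[F]_q) (Y12 : 'M[F]_(q, r)) (Y21 : 'M[F]_(r, q)) (Y22 : 'M[F]_r) :
  col3 (row3 X 0 0) (row3 0 Y11 Y12) (row3 0 Y21 Y22)
    = block_mx X 0 0 (block_mx Y11 Y12 Y21 Y22).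
Proof.
rewrite /col3 /row3 row_mx0 -[col_mx (row_mx 0 _) _]/(block_mx _ _ _ _).
by rewrite [block_mx 0 _ 0 _]block_mxEh col_mx0.
Qed.

(** * Positive semidefinite square roots *)

Lemma gram_eq0 (R : realDomainType) (p q : nat) (X : 'M[R]_(p, q)) :
  X^T *m X = 0 -> X = 0.
Proof.
move=> /matrixP XX; apply/matrixP => i j; have := XX j j; rewrite !mxE.
under eq_bigr do rewrite mxE -expr2.
move=> /eqP; rewrite psumr_eq0 => [|l _]; last exact: sqr_ge0.
by move=> /allP/(_ i); rewrite mem_index_enum sqrf_eq0 => /(_ isT)/eqP.
Qed.

Lemma gram_ge0 (R : realDomainType) (p : nat) (x : 'cV[R]_p) :
  0 <= (x^T *m x) 0 0.
Proof.
by rewrite mxE sumr_ge0 // => i _; rewrite mxE -expr2 sqr_ge0.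
Qed.

(** Lets an arbitrary function of a diagonalizable matrix be computed as a
    polynomial in it, which preserves realness and symmetry. *)
Lemma interpolation (F : fieldType) (f : F -> F) (s : seq F) :
  exists r : {poly F}, {in s, forall x, r.[x] = f x}.
Proof.
elim: s => [|a s [r rP]]; first by exists 0.
have [as_|as_] := boolP (a \in s).
  by exists r => x; rewrite inE => /predU1P[->|]; exact: rP.
set w := \prod_(b <- s) ('X - b%:P).
have wa : w.[a] != 0 by rewrite -[_ == 0]/(root w a) root_prod_XsubC.
exists (r + ((f a - r.[a]) / w.[a]) *: w) => x; rewrite inE.
case/predU1P => [->|xs]; first by rewrite !hornerE divfK // addrC subrK.
have /eqP wx : root w x by rewrite root_prod_XsubC.
by rewrite !hornerE wx mulr0 addr0 rP.
Qed.

(** Powers of S commute with S, so that reversing products does no harm. *)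
Lemma tr_horner_mx (R : comNzRingType) (p : nat) (S : 'M[R]_p.+1)
    (r : {poly R}) :
  S^T = S -> (horner_mx S r)^T = horner_mx S r.
Proof.
move=> Ssym; elim/poly_ind: r => [|r c IH]; first by rewrite !rmorph0 trmx0.
rewrite rmorphD rmorphM /= horner_mx_C horner_mx_X linearD /= tr_scalar_mx.
rewrite trmx_mul Ssym IH; congr (_ + _).
rewrite -[X in X *m _](horner_mx_X S) -[X in _ * X](horner_mx_X S) mulmxE.
by rewrite -!rmorphM mulrC.
Qed.

(** Applying S to an eigenvector v gives d |v|^2 = v S v^T. *)
Lemma psd_eigenvalue_ge0 (R : realType) (p : nat) (S : 'M[R]_p) (d : R) :
  psdmx S -> eigenvalue S d -> 0 <= d.
Proof.
move=> [_ Spsd] /eigenvalueP[v vS v0]; have := Spsd v^T.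
rewrite trmxK vS -scalemxAl mxE => h.
have vv0 : 0 <= (v *m v^T) 0 0 by rewrite -{1}[v]trmxK gram_ge0.
rewrite leNgt; apply: contraNN v0 => dlt0.
have /eqP vv : (v *m v^T) 0 0 == 0.
  by rewrite eq_le vv0 andbT -(nmulr_rge0 _ dlt0).
rewrite -[v]trmxK (@gram_eq0 _ _ _ v^T) ?trmx0 //.
by apply/matrixP => i j; rewrite trmxK !ord1 vv mxE.
Qed.

(** The diagonalization itself takes place over the complex numbers; the
    eigenvalues are real because S is Hermitian, and nonnegative because
    they have real eigenvectors too, being roots of the real characteristic
    polynomial. *)
Lemma psd_spectrum (R : realType) (p : nat) (S : 'M[R]_p.+1) : psdmx S ->
  exists (P : 'M[R[i]]_p.+1) (d : 'rV[R]_p.+1),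
    [/\ P \in unitmx, forall j, 0 <= d 0 j &
     map_mx (real_complex R) S
       = P *m diag_mx (map_mx (real_complex R) d) *m invmx P].
Proof.
move=> Spsd; set SC := map_mx _ S.
have SCreal : SC \is a realmx.
  apply/mxOverP => i j; rewrite mxE complex_real //.
have SCherm : SC \is hermsymmx.
  apply: realsym_hermsym => //; apply/is_hermitianmxP.
  by rewrite expr0 scale1r map_mx_id // /SC map_trmx Spsd.1.
have /orthomx_spectralP SCE := hermitian_normalmx SCherm.
have Punit := spectral_unit SC.
set P := spectralmx SC in SCE Punit *; set sp := spectral_diag SC in SCE *.
have spE : sp = map_mx (real_complex R) (map_mx (@complex.Re R) sp).
  apply/matrixP => i j; rewrite !mxE.
  have /mxOverP/(_ i j) := hermitian_spectral_diag_real SCherm.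
  by move=> /Creal_ReP; rewrite -/sp => h; rewrite -[LHS]h complexRe.
exists (invmx P), (map_mx (@complex.Re R) sp).
split; rewrite ?unitmx_inv //; last first.
  by rewrite -spE invmxK.
move=> j; rewrite mxE; apply: (psd_eigenvalue_ge0 Spsd).
rewrite eigenvalue_root_char -(fmorph_root (real_complex R)).
rewrite map_char_poly -eigenvalue_root_char.
apply/eigenvalueP; exists (row j P).
  rewrite -/SC SCE !mulmxA -row_mul mulmxV // row1.
  rewrite -rowE row_diag_mx -scalemxAl -rowE; congr (_ *: _).
  by have /matrixP/(_ 0 j) := spE; rewrite !mxE.
apply/eqP => Pj0; move: Punit; rewrite -row_free_unit -kermx_eq0.
move=> /eqP kP; have : delta_mx 0 j = 0 :> 'rV[R[i]]_p.+1.
  by apply/eqP; rewrite -submx0 -kP sub_kermx -rowE Pj0.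
by move/matrixP/(_ 0 j)/eqP; rewrite !mxE !eqxx oner_eq0.
Qed.

(** A symmetric fourth root T makes the positivity of the square root T^2
    evident, as x^T T^2 x = |T x|^2. *)
Lemma psd_fourth_root (R : realType) (p : nat) (S : 'M[R]_p) : psdmx S ->
  exists2 T : 'M[R]_p, T^T = T & T *m T *m (T *m T) = S.
Proof.
case: p S => [|p] S Spsd; first by exists 0; apply/matrixP => -[].
have [P [d [Punit d0 SE]]] := psd_spectrum Spsd.
have [r rP] := interpolation (fun x => Num.sqrt (Num.sqrt x))
  [seq d 0 j | j <- enum 'I_p.+1].
exists (horner_mx S r); first exact: tr_horner_mx Spsd.1.
apply: (map_mx_inj (f := real_complex R)).
rewrite !mulmxE -!rmorphM /= map_horner_mx.
rewrite SE horner_mx_uconj // horner_mx_diag; congr (_ *m diag_mx _ *m _).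
apply/rowP => j; rewrite !mxE horner_map !hornerM
 rP; last by apply: map_f; rewrite mem_enum.
by rewrite -!expr2 !sqr_sqrtr ?sqrtr_ge0 ?d0.
Qed.

(** [psd_sqrt] picks a square root when there is one, and the square of a
    symmetric fourth root is such a root. *)
Lemma psd_sqrtP (R : realType) (p : nat) (S : 'M[R]_p) : psdmx S ->
  psdmx (psd_sqrt S) /\ psd_sqrt S *m psd_sqrt S = S.
Proof.
move=> Spsd; have [T Tsym TS] := psd_fourth_root Spsd.
apply: (xgetPex 0 (P := [set Q | psdmx Q /\ Q *m Q = S]%classic)).
exists (T *m T); split=> //; split=> [|x]; first by rewrite trmx_mul Tsym.
by rewrite !mulmxA -mulmxA -{1}Tsym -trmx_mul gram_ge0.
Qed.

(** * The orthogonal decomposition attached to M and D *)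

Section OrthogonalDecomposition.
Variable R : realType.

Lemma sub_orthc (p q r : nat) (X : 'M[R]_(r, q)) (U : 'M[R]_(p, q)) :
  (X <= orthc U)%MS = (X *m U^T == 0).
Proof. exact: sub_kermx. Qed.

Lemma sub_kerc (p q r : nat) (X : 'M[R]_(r, q)) (Y : 'M[R]_(p, q)) :
  (X <= kerc Y)%MS = (X *m Y^T == 0).
Proof. exact: sub_kermx. Qed.

(** Writing X = Z U gives X X^T = X U^T Z^T = 0; the real inner product is
    definite. *)
Lemma orthc_disjoint (p q r : nat) (X : 'M[R]_(r, q)) (U : 'M[R]_(p, q)) :
  (X <= U)%MS -> (X <= orthc U)%MS -> X = 0.
Proof.
case/submxP => Z XE; rewrite sub_orthc => /eqP XU.
rewrite -[X]trmxK (@gram_eq0 _ _ _ X^T) ?trmx0 // trmxK.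
by rewrite {2}XE trmx_mul mulmxA XU mul0mx.
Qed.

Lemma capmx_orthc (q : nat) (U : 'M[R]_q) : (U :&: orthc U = 0)%MS.
Proof. by apply: (orthc_disjoint (U := U)); rewrite ?capmxSl ?capmxSr. Qed.

(** One inclusion is formal, and the dimensions agree. *)
Lemma orthcK (q : nat) (U : 'M[R]_q) : (orthc (orthc U) :=: U)%MS.
Proof.
apply: eqmx_sym; apply/eqmxP; rewrite -(geq_leqif (mxrank_leqif_eq _)).
  by rewrite !mxrank_ker !mxrank_tr mxrank_ker mxrank_tr subKn ?rank_leq_row.
by rewrite sub_orthc -[U in U *m _]trmxK -trmx_mul mulmx_ker trmx0.
Qed.

(** Membership in U^perp can be tested against a basis of U. *)
Lemma orthonormal_basis_orthc (p d r : nat) (U : 'M[R]_p) (V : 'M[R]_(p, d))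
    (X : 'M[R]_(r, p)) : orthonormal_basis U V -> X *m V = 0 ->
  (X <= orthc U)%MS.
Proof.
case=> _ /eqmxP VU XV; have /submxP[Z ->] : (U <= V^T)%MS by rewrite VU.
by rewrite sub_orthc trmx_mul trmxK mulmxA XV mul0mx.
Qed.

Lemma orthonormal_basis_mul0 (p d r : nat) (U : 'M[R]_p) (V : 'M[R]_(p, d))
    (X : 'M[R]_(r, p)) : orthonormal_basis U V -> X *m U^T = 0 ->
  X *m V = 0.
Proof.
case=> _ /eqmxP VU XU; have /submxP[Z VZ] : (V^T <= U)%MS by rewrite VU.
by rewrite -[V]trmxK VZ trmx_mul mulmxA XU mul0mx.
Qed.

(** The projection onto ker M kills exactly the complement of ker M, so the
    projection can be eliminated from the definition of X3. *)
Lemma sub_subX3 (m r : nat) (M D : 'M[R]_m) (X : 'M[R]_(r, m)) :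
  (X <= subX3 M D)%MS =
  (X <= kerc M)%MS && (X *m D^T <= orthc (kerc M))%MS.
Proof.
rewrite sub_capmx [X in _ && X]sub_kerc trmx_mul trmxK mulmxA; congr (_ && _).
apply/eqP/idP => [XP|]; last by apply: proj_mx_0; exact: capmx_orthc.
set K := kerc M in XP *; have := @proj_mx_compl_sub _ _ _ K (orthc K) (X *m D^T).
rewrite XP subr0; apply.
suff -> : (K + orthc K :=: 1%:M)%MS by rewrite submx1.
apply/eqmxP; rewrite -(geq_leqif (mxrank_leqif_eq (submx1 _))).
rewrite mxrank1 mxrank_disjoint_sum ?capmx_orthc //.
by rewrite [\rank (orthc _)]mxrank_ker mxrank_tr subnKC ?rank_leq_row.
Qed.

Variables (m m1 m2 m3 : nat) (M D : 'M[R]_m).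
Variables (V1 : 'M[R]_(m, m1)) (V2 : 'M[R]_(m, m2)) (V3 : 'M[R]_(m, m3)).
Hypotheses (hM : M^T = M) (hD : D^T = - D).
Hypotheses (hV1 : orthonormal_basis (subX1 M) V1)
  (hV2 : orthonormal_basis (subX2 M D) V2)
  (hV3 : orthonormal_basis (subX3 M D) V3).

Let K := kerc M.

Let V1K : V1^T *m K^T = 0.
Proof. by apply/eqP; rewrite -sub_orthc (eqmxP hV1.2). Qed.

Let V2K : (V2^T <= K)%MS.
Proof. by rewrite (eqmxP hV2.2) capmxSl. Qed.

Let V3K : (V3^T <= K)%MS.
Proof. by rewrite (eqmxP hV3.2) capmxSl. Qed.

Let KV1 : K *m V1 = 0.
Proof. by rewrite -[K]trmxK -[V1]trmxK -trmx_mul V1K trmx0. Qed.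

Let V3D : V3^T *m D *m K^T = 0.
Proof.
have : (V3^T <= subX3 M D)%MS by rewrite (eqmxP hV3.2).
rewrite sub_subX3 => /andP[_]; rewrite sub_orthc hD mulmxN mulNmx oppr_eq0.
by move/eqP.
Qed.

Let mulK0 p d (X : 'M[R]_(p, m)) (V : 'M[R]_(m, d)) : (V^T <= K)%MS ->
  X *m K^T = 0 -> X *m V = 0.
Proof.
by case/submxP=> Z VZ XK; rewrite -[V]trmxK VZ trmx_mul mulmxA XK mul0mx.
Qed.

Lemma M_annihilates_X2 : M *m V2 = 0.
Proof. by apply: mulK0 => //; rewrite -[M]trmxK -trmx_mul mulmx_ker trmx0. Qed.

Lemma M_annihilates_X3 : M *m V3 = 0.
Proof. by apply: mulK0 => //; rewrite -[M]trmxK -trmx_mul mulmx_ker trmx0. Qed.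

Lemma X1_orthogonal_X2 : V1^T *m V2 = 0. Proof. exact: mulK0. Qed.
Lemma X1_orthogonal_X3 : V1^T *m V3 = 0. Proof. exact: mulK0. Qed.

Lemma X2_orthogonal_X3 : V2^T *m V3 = 0.
Proof.
apply: (orthonormal_basis_mul0 hV3); apply/eqP.
by rewrite -sub_orthc (eqmxP hV2.2) capmxSr.
Qed.

(** D maps X3 into the complement of ker M, whereas X2 and X3 lie in ker M. *)
Lemma D_block33_eq0 : V3^T *m D *m V3 = 0. Proof. exact: mulK0. Qed.

Lemma D_block32_eq0 : V3^T *m D *m V2 = 0. Proof. exact: mulK0. Qed.

Lemma D_block23_eq0 : V2^T *m D *m V3 = 0.
Proof.
apply: trmx_inj; rewrite !trmx_mul trmxK hD mulNmx mulmxN mulmxA.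
by rewrite D_block32_eq0 oppr0 trmx0.
Qed.

(** A vector orthogonal to X1 lies in ker M; if it is also orthogonal to X3
    it lies in X2, and orthogonality to X2 then leaves only 0. *)
Lemma sum_orthogonal_projections : V1 *m V1^T + V2 *m V2^T + V3 *m V3^T = 1%:M.
Proof.
apply/esym/eqP; rewrite -subr_eq0; set X := _ - _.
have V2V1 : V2^T *m V1 = 0 by rewrite -[V1]trmxK -trmx_mul X1_orthogonal_X2 trmx0.
have V3V1 : V3^T *m V1 = 0 by rewrite -[V1]trmxK -trmx_mul X1_orthogonal_X3 trmx0.
have V3V2 : V3^T *m V2 = 0 by rewrite -[V2]trmxK -trmx_mul X2_orthogonal_X3 trmx0.
have X1 : X *m V1 = 0.
  rewrite mulmxBl mul1mx !mulmxDl -!mulmxA hV1.1 V2V1 V3V1.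
  by rewrite !mulmx0 !addr0 mulmx1 subrr.
have X2 : X *m V2 = 0.
  rewrite mulmxBl mul1mx !mulmxDl -!mulmxA hV2.1 X1_orthogonal_X2 V3V2.
  by rewrite !mulmx0 addr0 add0r mulmx1 subrr.
have X3 : X *m V3 = 0.
  rewrite mulmxBl mul1mx !mulmxDl -!mulmxA hV3.1 X2_orthogonal_X3.
  by rewrite X1_orthogonal_X3 !mulmx0 !add0r mulmx1 subrr.
apply/eqP/(orthc_disjoint (U := subX2 M D)); last first.
  exact: orthonormal_basis_orthc hV2 X2.
rewrite sub_capmx (orthonormal_basis_orthc hV3 X3) andbT.
by have := orthonormal_basis_orthc hV1 X1; rewrite orthcK.
Qed.

(** M is symmetric, so its kernel meets the orthogonal complement X1 of the
    kernel only in 0, and M maps X1 to itself. *)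
Lemma M_block11_unit : V1^T *m M *m V1 \in unitmx.
Proof.
apply: unitmx_row0 => x; rewrite !mulmxA => h.
have := orthonormal_basis_orthc hV1 h; rewrite orthcK sub_kerc hM => /eqP xMM.
have xM : x *m V1^T *m M = 0.
  apply: trmx_inj; rewrite trmx0; apply: gram_eq0.
  by rewrite trmxK [X in _ *m X]trmx_mul hM mulmxA xMM mul0mx.
have x0 : x *m V1^T = 0.
  apply: (orthc_disjoint (U := K)); first by rewrite sub_kerc hM xM.
  by rewrite sub_orthc -mulmxA V1K mulmx0.
by rewrite -[x]mulmx1 -hV1.1 mulmxA x0 mul0mx.
Qed.

(** If v in X2 and D v is orthogonal to X2, then D v is orthogonal to the
    whole of ker M = X2 + X3, which puts v in X3. *)
Lemma D_block22_unit : V2^T *m D *m V2 \in unitmx.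
Proof.
apply: unitmx_row0 => x; rewrite !mulmxA => h.
have zV3 : x *m V2^T *m D *m V3 = 0.
  by rewrite -!mulmxA [X in _ *m X]mulmxA D_block23_eq0 mulmx0.
have zK : x *m V2^T *m D *m K^T = 0.
  have -> : K^T = V2 *m V2^T *m K^T + V3 *m V3^T *m K^T.
    rewrite -[LHS]mul1mx -sum_orthogonal_projections !mulmxDl.
    by rewrite -[V1 *m _ *m _]mulmxA V1K mulmx0 add0r.
  by rewrite mulmxDr !mulmxA h zV3 !mul0mx addr0.
have x0 : x *m V2^T = 0.
  apply: (orthc_disjoint (U := subX3 M D)).
    rewrite sub_subX3 (submx_trans (submxMl _ _) V2K) /=.
    by rewrite sub_orthc hD mulmxN mulNmx zK oppr0.
  by rewrite (submx_trans (submxMl _ _)) // (eqmxP hV2.2) capmxSr.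
by rewrite -[x]mulmx1 -hV2.1 mulmxA x0 mul0mx.
Qed.

End OrthogonalDecomposition.

(** * Controllability through stable subspaces *)

Section Reachability.
Variable F : fieldType.

(** Equivalent to controllability (a Popov-Belevitch-Hautus test with stable
    spaces in place of eigenvectors). In this form it is insensitive to the
    number of powers of A considered and passes easily to resolvents and
    block sums. *)
Definition reachable (n m : nat) (A : 'M[F]_n) (B : 'M[F]_(n, m)) : Prop :=
  forall (p : nat) (U : 'M[F]_(p, n)),
    (U *m A <= U)%MS -> U *m B = 0 -> U = 0.

Lemma mulmx_exprS (n : nat) (A : 'M[F]_n) (i : nat) :
  A *m A ^+ i = A ^+ i.+1.
Proof. by rewrite exprS. Qed.

Lemma mulmx_exp2 (n : nat) (A : 'M[F]_n) : A *m A = A ^+ 2.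
Proof. by rewrite expr2. Qed.

Lemma stablemx_exp (n p : nat) (A : 'M[F]_n) (U : 'M[F]_(p, n)) (i : nat) :
  (U *m A <= U)%MS -> (U *m A ^+ i <= U)%MS.
Proof.
move=> UA; elim: i => [|i IH]; first by rewrite expr0 mulmx1.
by rewrite exprSr -mulmxE mulmxA (submx_trans (submxMr _ IH)).
Qed.

Lemma stable_mulmx0 (n m p : nat) (A : 'M[F]_n) (B : 'M[F]_(n, m))
    (U : 'M[F]_(p, n)) (i : nat) :
  (U *m A <= U)%MS -> U *m B = 0 -> U *m A ^+ i *m B = 0.
Proof.
move=> /(@stablemx_exp _ _ _ _ i)/submxP[Z ->] UB.
by rewrite -mulmxA UB mulmx0.
Qed.

(** By the Cayley-Hamilton theorem every power of A is a combination of the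
    first n. *)
Lemma mulmx_expr_sub (n m p : nat) (A : 'M[F]_n) (B : 'M[F]_(n, m))
    (U : 'M[F]_(p, n)) :
  (forall i, (i < n)%N -> U *m A ^+ i *m B = 0) ->
  forall i, U *m A ^+ i *m B = 0.
Proof.
case: n => [|n] in A B U * => h i.
  by rewrite [U]thinmx0 !mul0mx.
set r := 'X^i %% char_poly A.
have -> : A ^+ i = horner_mx A r.
  rewrite -{1}(horner_mx_X A) -rmorphXn /= [in LHS](divp_eq 'X^i (char_poly A)).
  by rewrite rmorphD rmorphM /= Cayley_Hamilton mulr0 add0r.
have rn : (size r <= n.+1)%N.
  rewrite -ltnS -(size_char_poly A) ltn_modp.
  by rewrite -size_poly_eq0 size_char_poly.
rewrite -[r]coefK poly_def rmorph_sum /= mulmx_sumr mulmx_suml big1 // => j _.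
rewrite -mul_polyC rmorphM /= horner_mx_C rmorphXn /= horner_mx_X.
rewrite -mulmxE mul_scalar_mx -scalemxAr -scalemxAl h ?scaler0 //.
exact: leq_trans (ltn_ord j) rn.
Qed.

(** The left kernel of [B AB ... A^(n-1)B] is A-stable and kills B, hence is
    0. *)
Lemma reachable_right_inverse (n m : nat) (A : 'M[F]_n) (B : 'M[F]_(n, m)) :
  reachable A B ->
  exists Y : 'I_n -> 'M[F]_(m, n), \sum_(i < n) A ^+ i *m B *m Y i = 1%:M.
Proof.
move=> rAB; set S := \mxrow_(i < n) (A ^+ i *m B).
have kS i : (i < n)%N -> kermx S *m A ^+ i *m B = 0.
  move=> ilt; have := mulmx_ker S; rewrite mul_mxrow.
  move/(congr1 (fun X => submxrow X (Ordinal ilt))).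
  by rewrite mxrowK submxrow0 mulmxA.
have S_free : row_free S.
  rewrite -kermx_eq0; apply/eqP/(rAB).
    rewrite sub_kermx mul_mxrow; apply/eqP.
    rewrite -[RHS](mxrow0 (q_ := fun=> m)).
    apply/eq_mxrow => i; rewrite !mulmxA -[kermx S *m A *m A ^+ i]mulmxA.
    by rewrite mulmx_exprS mulmx_expr_sub.
  by have := mulmx_expr_sub kS 0; rewrite expr0 mulmx1.
exists (fun i => submxcol (pinvmx S) i).
by rewrite -mul_mxrow_mxcol submxcolK mulmxVp.
Qed.

Lemma reachable_unit (n m : nat) (A g : 'M[F]_n) (B : 'M[F]_(n, m)) :
  reachable A B -> g \in unitmx -> g *m A = A *m g -> reachable A (g *m B).
Proof.
move=> rAB gU gA p U UA; rewrite mulmxA => UgB.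
have Ug0 : U *m g = 0.
  by apply: rAB UgB; rewrite -mulmxA gA mulmxA submxMr.
by rewrite -[U]mulmx1 -(mulmxV gU) mulmxA Ug0 mul0mx.
Qed.

Lemma reachable_opp (n m : nat) (A : 'M[F]_n) (B : 'M[F]_(n, m)) :
  reachable A B -> reachable (- A) B.
Proof.
by move=> rAB p U; rewrite mulmxN eqmx_opp; exact: rAB.
Qed.

(** In finite dimension a space stable under an invertible matrix is stable
    under its inverse, so A and its resolvents have the same stable spaces. *)
Lemma reachable_resolvent (n m : nat) (A : 'M[F]_n) (B : 'M[F]_(n, m)) (s : F) :
  s%:M - A \in unitmx -> reachable A B -> reachable (invmx (s%:M - A)) B.
Proof.
move=> sA rAB p U US; apply: rAB.
set S := s%:M - A in sA US.
have [Z ZE] := submxP US.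
have US' : (U <= U *m invmx S)%MS.
  rewrite -(geq_leqif (mxrank_leqif_sup US)).
  by rewrite mxrankMfree // row_free_unit unitmx_inv.
have US'' : (U *m S <= U)%MS.
  by rewrite (submx_trans (submxMr S US')) // -mulmxA mulVmx // mulmx1.
have -> : A = s%:M - S by rewrite opprB addrC subrK.
by rewrite mulmxBr mul_mx_scalar addmx_sub ?scalemx_sub // eqmx_opp.
Qed.

(** Squaring kills the nilpotent block: multiplying a stable space by diag
    (T, J)^2 projects it to the first block, where it must vanish, T being
    invertible. *)
Lemma reachable_block_diag (k r m : nat) (T : 'M[F]_k) (J : 'M[F]_r)
    (B1 : 'M[F]_(k, m)) (B2 : 'M[F]_(r, m)) :
  T \in unitmx -> J *m J = 0 -> reachable T B1 -> reachable J B2 ->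
  reachable (block_mx T 0 0 J) (col_mx B1 B2).
Proof.
move=> Tu JJ rT rJ p U; rewrite -[U]hsubmxK.
set U1 := lsubmx U; set U2 := rsubmx U => /submxP[Z].
rewrite mul_row_block !mulmx0 addr0 add0r mul_mx_row => /eq_row_mx[U1T U2J].
rewrite mul_row_col => UB.
have U10 : U1 = 0.
  have : U1 *m T *m T = 0.
    apply: rT; first by rewrite {1}U1T -!mulmxA submxMl.
    (* Z Z U = U diag (T, J)^2, and J^2 = 0 removes the second block. *)
    have := congr1 (fun X => Z *m (Z *m X)) UB.
    rewrite !mulmx0 !mulmxDr !mulmxA -[Z *m Z *m U1]mulmxA -[Z *m Z *m U2]mulmxA.
    rewrite -U1T -U2J !mulmxA -U1T -U2J.
    by rewrite -[U2 *m J *m J]mulmxA JJ mulmx0 mul0mx addr0.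
  by move/(congr1 (fun X => X *m invmx T *m invmx T)); rewrite !mulmxK // !mul0mx.
rewrite U10 mul0mx add0r in UB.
rewrite U10 (rJ _ U2) ?row_mx0 //.
by rewrite U2J submxMl.
Qed.

(** A rank factorization J = L S reduces the matrix to [0 1; 1 *], which is
    invertible whatever the last block. *)
Lemma rank_antidiag_ge (p q : nat) (J : 'M[F]_(p, q)) (G : 'M[F]_(p, q)) :
  (\rank J + \rank J <= \rank (block_mx 0 J J G))%N.
Proof.
set L := col_base J; set S := row_base J.
have [L' L'L] : exists L', L' *m L = 1%:M by apply/row_fullP/col_base_full.
have [S' SS'] : exists S', S *m S' = 1%:M by apply/row_freeP/row_base_free.
have JE : L' *m J *m S' = 1%:M.
  by rewrite -[X in _ *m X *m _](mulmx_base J) mulmxA L'L mul1mx SS'.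
pose X := block_mx L' 0 0 L'; pose Y := block_mx S' 0 0 S'.
have E : X *m block_mx 0 J J G *m Y
    = block_mx 0 1%:M 1%:M (L' *m G *m S') :> 'M_(\rank J + \rank J).
  by rewrite /X /Y !mulmx_block !(mulmx0, mul0mx, addr0, add0r) JE.
have U : block_mx 0 1%:M 1%:M (L' *m G *m S') \in unitmx.
  have [] // := @mulmx1_unit _ _ (block_mx 0 1%:M 1%:M (L' *m G *m S'))
    (block_mx (- (L' *m G *m S')) 1%:M 1%:M 0).
  rewrite mulmx_block !(mulmx0, mul0mx, mulmx1, mul1mx, addr0, add0r).
  by rewrite addNr -scalar_mx_block.
rewrite -[leqLHS](mxrank_unit U) -E.
by apply: leq_trans (mxrankM_maxl _ _) (mxrankM_maxr _ _).
Qed.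

(** The moment with j = 0 is deliberately not compared, since a realization
    may change it through its feedthrough. The block O2 Q2 below is
    therefore arbitrary, and [rank_antidiag_ge] provides a bound that does
    not depend on it. *)
Lemma dimension_bound (N k r m q : nat) (T : 'M[F]_N) (C : 'M[F]_(q, N))
    (B : 'M[F]_(N, m)) (T1 : 'M[F]_k) (J : 'M[F]_r)
    (T0 := block_mx T1 0 0 J) (C0 : 'M[F]_(q, k + r)) (B0 : 'M[F]_(k + r, m)) :
  T1 \in unitmx -> J *m J = 0 -> reachable T0 B0 -> reachable T0^T C0^T ->
  (forall j, C *m T ^+ j.+1 *m B = C0 *m T0 ^+ j.+1 *m B0) ->
  (k + 2 * \rank J <= N)%N.
Proof.
move=> T1u JJ rB rC h.
have [Y YP] := reachable_right_inverse rB.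
have [X XP] := reachable_right_inverse rC.
have {}XP : \sum_i (X i)^T *m C0 *m T0 ^+ i = 1%:M.
  rewrite -[RHS]trmx1 -XP linear_sum; apply: eq_bigr => i _ /=.
  rewrite !trmx_mul trmxK mulmxA; congr (_ *m _).
  elim: (i : nat) => [|l IH]; first by rewrite !expr0 trmx1.
  by rewrite exprSr exprS -!mulmxE trmx_mul trmxK -IH.
(* Left and right inverses for the observability and controllability matrices
   of T0, applied to those of T. *)
pose O := \sum_(i < k + r) (X i)^T *m C *m T ^+ i.
pose Q := \sum_(j < k + r) T ^+ j *m B *m Y j.
have OQ l : O *m T ^+ l.+1 *m Q = T0 ^+ l.+1.
  rewrite -[RHS]mulmx1 -YP -[RHS]mul1mx -XP mulmxA !mulmx_suml.
  apply: eq_bigr => i _; rewrite !mulmx_sumr; apply: eq_bigr => j _.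
  rewrite !mulmxA; congr (_ *m _).
  have e n (S : 'M[F]_n) : S ^+ (i + l + j).+1 = S ^+ i *m S ^+ l.+1 *m S ^+ j.
    by rewrite !mulmxE -!exprD addnS addSn.
  have := h (i + l + j)%N; rewrite !e => /(congr1 (fun Z => (X i)^T *m Z)).
  by rewrite !mulmxA.
have T0E : T0 ^+ 2 = block_mx (T1 *m T1) 0 0 0.
  rewrite expr2 -mulmxE mulmx_block !mulmx0 !mul0mx !addr0 JJ.
  by congr block_mx; rewrite add0r.
have OQ1 := OQ 0%N; have OQ2 := OQ 1%N.
rewrite T0E in OQ2; rewrite expr1 in OQ1.
pose O1 := usubmx O; pose O2 := dsubmx O.
pose Q1 := lsubmx Q; pose Q2 := rsubmx Q.
have OE : O = col_mx O1 O2 by rewrite vsubmxK.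
have QE : Q = row_mx Q1 Q2 by rewrite hsubmxK.
move: OQ1; rewrite OE QE mul_col_mx mul_col_row => /eq_block_mx[_ a12 a21 a22].
move: OQ2; rewrite OE QE mul_col_mx mul_col_row => /eq_block_mx[b11 b12 b21 b22].
(* The nilpotent block enters both shifted and unshifted. The invertible block
   enters shifted only: there the unshifted product O1 Q1 would be unknown. *)
pose L := col_mx (O1 *m T) (col_mx (O2 *m T) O2).
pose P := row_mx (T *m Q1) (row_mx (T *m Q2) Q2).
have LP : L *m P = block_mx (T1 *m T1) 0 0 (block_mx 0 J J (O2 *m Q2)).
  rewrite /L /P mul_col_row; congr block_mx.
  - by rewrite -b11 expr2 -mulmxE !mulmxA.
  - rewrite mul_mx_row a12 mulmxA -[O1 *m T *m T]mulmxA [T *m T]mulmx_exp2 b12.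
    by rewrite row_mx0.
  - rewrite mul_col_mx mulmxA -[O2 *m T *m T]mulmxA [T *m T]mulmx_exp2 b21.
    by rewrite mulmxA a21 col_mx0.
  rewrite mul_col_row !mulmxA a22; congr block_mx.
  by rewrite -[O2 *m T *m T]mulmxA [T *m T]mulmx_exp2 b22.
have rT1 : \rank (T1 *m T1) = k by rewrite mxrank_unit // unitmx_mul T1u.
have : (\rank (L *m P) <= N)%N.
  by apply: leq_trans (mxrankM_maxl _ _) (rank_leq_col _).
apply: leq_trans; rewrite LP rank_diag_block_mx rT1 leq_add2l.
by rewrite mul2n -addnn rank_antidiag_ge.
Qed.

(** The nilpotent part of the Weierstrass form of a realization of a
    transfer function whose polynomial part has degree one. *)
Definition jordan2 (p : nat) : 'M[F]_(p + p) := block_mx 0 1%:M 0 0.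

Lemma jordan2_sq0 (p : nat) : jordan2 p *m jordan2 p = 0.
Proof.
by rewrite mulmx_block !(mulmx0, mul0mx, addr0) block_mx0.
Qed.

Lemma rank_jordan2 (p : nat) : \rank (jordan2 p) = p.
Proof.
by rewrite /jordan2 /block_mx row_mx0 rank_col_mx0 rank_row_0mx mxrank1.
Qed.

Lemma reachable_jordan2 (p q : nat) (K : 'M[F]_(p, q)) :
  row_free K -> reachable (jordan2 p) (col_mx 0 K).
Proof.
move=> Kf r U; rewrite -[U]hsubmxK; set U1 := lsubmx U; set U2 := rsubmx U.
rewrite (mul_row_col U1 U2 0) mulmx0 add0r => /submxP[Z UZ] /eqP.
rewrite mulmx_free_eq0 // => /eqP U20; move: UZ; rewrite U20.
rewrite mul_row_block mul_mx_row !mulmx0 !add0r mulmx1 addr0.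
by move=> /eq_row_mx[_ ->]; rewrite row_mx0.
Qed.

Lemma reachable_tr_jordan2 (p q : nat) (K : 'M[F]_(p, q)) :
  row_free K -> reachable (jordan2 p)^T (col_mx K 0).
Proof.
move=> Kf r U; rewrite -[U]hsubmxK; set U1 := lsubmx U; set U2 := rsubmx U.
rewrite (mul_row_col U1 U2 K) mulmx0 addr0 => /submxP[Z UZ] /eqP.
rewrite mulmx_free_eq0 // => /eqP U10; move: UZ; rewrite U10.
rewrite tr_block_mx !trmx0 trmx1 mul_row_block mul_mx_row !mulmx0 !add0r mulmx1.
by move=> /eq_row_mx[-> _]; rewrite row_mx0.
Qed.

End Reachability.

Lemma reachable_of_controllable (R : realType) (n m : nat) (A : 'M[R]_n)
    (B : 'M[R]_(n, m)) : controllable A B -> reachable A B.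
Proof.
move=> cAB p U UA UB; have cf : row_free (ctrbmx A B) by apply/eqP.
apply/eqP; rewrite -(mulmx_free_eq0 _ cf) /ctrbmx mul_mxrow.
apply/eqP; rewrite -[RHS](mxrow0 (q_ := fun=> m)); apply/eq_mxrow => i.
by rewrite mulmxA stable_mulmx0.
Qed.

(** * Realizations over the rational functions *)

Section Transfer.
Variable R : realType.

HB.instance Definition _ := GRing.RMorphism.copy (@const_ratfun R)
  (@FracField.tofrac {poly R[i]} \o polyC \o real_complex R).

Notation inj := (@const_ratfun R).
Notation frac := (@FracField.tofrac {poly R[i]}).
Notation cst := (fun a : R => (real_complex R a)%:P).

(** The pencil before passage to fractions, so that it can be evaluated at
    points. *)
Definition poly_pencil (N : nat) (E A : 'M[R]_N) : 'M[{poly R[i]}]_N :=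
  'X *: map_mx cst E - map_mx cst A.

Lemma pencilE (N : nat) (E A : 'M[R]_N) :
  zvar R *: const_ratmx E - const_ratmx A = map_mx frac (poly_pencil E A).
Proof. by apply/matrixP => i j; rewrite !mxE rmorphB rmorphM. Qed.

Lemma poly_pencil_horner (N : nat) (E A : 'M[R]_N) (s : R) :
  map_mx (horner_eval (real_complex R s)) (poly_pencil E A)
    = map_mx (real_complex R) (s *: E - A).
Proof.
apply/matrixP => i j; rewrite !mxE horner_evalE !hornerE.
by rewrite rmorphB rmorphM.
Qed.

Lemma det_pencil_horner (N : nat) (E A : 'M[R]_N) (s : R) :
  (\det (poly_pencil E A)).[real_complex R s]
    = real_complex R (\det (s *: E - A)).
Proof.
by rewrite -horner_evalE -det_map_mx poly_pencil_horner det_map_mx.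
Qed.

Lemma pencil_neq0 (N : nat) (E A : 'M[R]_N) (s : R) :
  s *: E - A \in unitmx -> \det (zvar R *: const_ratmx E - const_ratmx A) != 0.
Proof.
rewrite unitmxE unitfE => sEA.
rewrite pencilE det_map_mx tofrac_eq0.
apply: contraNneq sEA => d0; have := det_pencil_horner E A s.
by rewrite d0 horner0 => /esym/eqP; rewrite fmorph_eq0.
Qed.

(** A nonzero polynomial has fewer roots than there are natural numbers. *)
Lemma pencil_regular_point (N : nat) (E A : 'M[R]_N) :
  \det (zvar R *: const_ratmx E - const_ratmx A) != 0 ->
  exists s : R, s *: E - A \in unitmx.
Proof.
rewrite pencilE det_map_mx tofrac_eq0 => d0.
set d := \det _ in d0.
set rs := [seq real_complex R i%:R | i <- iota 0 (size d)].
have [/(max_poly_roots d0)|/allPn[_ /mapP[i _ ->] di]] := boolP (all (root d) rs).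
  rewrite map_inj_uniq ?iota_uniq => [|i j /complexI/eqP]; last first.
    by rewrite eqr_nat => /eqP.
  by rewrite size_map size_iota ltnn => /(_ isT).
exists i%:R; rewrite unitmxE unitfE.
apply: contraNneq di => di; apply/rootP.
by rewrite det_pencil_horner di rmorph0.
Qed.

(** A constant that is divisible by z - s among the functions regular at s
    vanishes at s, hence is 0. *)
Lemma regular_const (p q : nat) (c : 'M[R]_(p, q)) (s : R)
    (d : {poly R[i]}) (Y : 'M[{poly R[i]}]_(p, q)) :
  d.[real_complex R s] != 0 ->
  const_ratmx c = (zvar R - inj s) *: ((frac d)^-1 *: map_mx frac Y) -> c = 0.
Proof.
move=> ds cE; apply/matrixP => i j; rewrite mxE.
have d0 : frac d != 0.
  by rewrite tofrac_eq0; apply: contraNneq ds => ->; rewrite horner0.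
have /matrixP/(_ i j) := cE; rewrite !mxE.
move=> /(congr1 (fun x => x * frac d)).
rewrite -mulrA [_^-1 * _]mulrC -[_ * _ * frac d]mulrA mulVf // mulr1.
rewrite /zvar /const_ratfun -tofracB -!tofracM => /eqP; rewrite tofrac_eq.
move=> /eqP/(congr1 (horner_eval (real_complex R s))).
rewrite !horner_evalE !hornerE subrr mul0r => /eqP.
by rewrite mulf_eq0 (negPf ds) orbF fmorph_eq0 => /eqP.
Qed.

Lemma const_ratmxE (p q : nat) (X : 'M[R]_(p, q)) :
  const_ratmx X = map_mx frac (map_mx cst X).
Proof. by rewrite -map_mx_comp. Qed.

Lemma zvar_sub_neq0 (s : R) : zvar R - inj s != 0.
Proof. by rewrite /zvar /const_ratfun -tofracB tofrac_eq0 polyXsubC_eq0. Qed.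

(** Writing z E - A = P (1 + u T) with u = z - s, the functions S j = C T^j
    (1 + u T)^-1 P^-1 B are regular at s and satisfy S j = C T^j P^-1 B - u
    S (j + 1). If S j is constant, [regular_const] shows that u S (j + 1) =
    0 and that C T^j P^-1 B is that constant; start from S 0 = - D. *)
Lemma constant_transfer_moments (N p q : nat) (E A : 'M[R]_N)
    (B : 'M[R]_(N, q)) (C : 'M[R]_(p, N)) (D : 'M[R]_(p, q)) (s : R)
    (P := s *: E - A) (T := invmx P *m E) :
  P \in unitmx ->
  const_ratmx D + const_ratmx C
    *m invmx (zvar R *: const_ratmx E - const_ratmx A) *m const_ratmx B = 0 ->
  forall j, C *m T ^+ j.+1 *m (invmx P *m B) = 0.
Proof.
move=> Pu tr0.
set u := zvar R - inj s.
have u0 : u != 0 by exact: zvar_sub_neq0.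
pose Q := zvar R *: const_ratmx T - const_ratmx (s *: T - 1%:M).
have Q0 : \det Q != 0.
  by apply: (pencil_neq0 (s := s)); rewrite subKr unitmx1.
have Qu : Q \in unitmx by rewrite unitmxE unitfE.
have QE : Q = 1%:M + u *: const_ratmx T.
  rewrite /Q /const_ratmx map_mxB map_mxZ map_mx1 scalerBl.
  by rewrite opprB addrCA.
have PE : zvar R *: const_ratmx E - const_ratmx A = const_ratmx P *m Q.
  rewrite QE mulmxDr mulmx1 -scalemxAr /const_ratmx -map_mxM mulmxA mulmxV //.
  by rewrite mul1mx map_mxB map_mxZ scalerBl [RHS]addrC addrA subrK.
pose S j := const_ratmx (C *m T ^+ j) *m invmx Q *m const_ratmx (invmx P *m B).
pose Y j := map_mx cst (C *m T ^+ j)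
  *m \adj (poly_pencil T (s *: T - 1%:M)) *m map_mx cst (invmx P *m B).
pose d := \det (poly_pencil T (s *: T - 1%:M)).
have SE j : S j = (frac d)^-1 *: map_mx frac (Y j).
  rewrite /S /Y !const_ratmxE !map_mxM /= /invmx Qu -scalemxAr -scalemxAl.
  by rewrite /Q pencilE det_map_mx map_mx_adj.
have ds : d.[real_complex R s] != 0.
  by rewrite det_pencil_horner subKr det1 rmorph1 oner_eq0.
have step j c : S j = const_ratmx c ->
    S j.+1 = 0 /\ C *m T ^+ j *m (invmx P *m B) = c.
  have e : const_ratmx (C *m T ^+ j *m (invmx P *m B)) = S j + u *: S j.+1.
    rewrite /S /const_ratmx exprSr -mulmxE; move: (invmx P *m B) => b.
    rewrite (mulmxA C) !(map_mxM _ (C *m _)) /= !scalemxAl -mulmxDl -mulmxDl.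
    set X := map_mx _ (C *m _).
    have -> : X + u *: X *m map_mx inj T = X *m Q.
      by rewrite QE mulmxDr mulmx1 -scalemxAr -scalemxAl.
    by rewrite mulmxK.
  move=> Sc.
  have h : const_ratmx (C *m T ^+ j *m (invmx P *m B) - c) = u *: S j.+1.
    by rewrite /const_ratmx map_mxB -!/(const_ratmx _) e Sc addrAC subrr add0r.
  have /eqP : C *m T ^+ j *m (invmx P *m B) - c = 0.
    by apply: (regular_const (Y := Y j.+1) ds); rewrite h SE.
  rewrite subr_eq0 => /eqP c0; split=> //.
  move/esym/eqP: h; rewrite c0 subrr /const_ratmx map_mx0 scaler_eq0.
  by rewrite (negPf u0) => /eqP.
have S0 : S 0%N = const_ratmx (- D).
  rewrite /S expr0 mulmx1 /const_ratmx map_mxM map_mxN -!/(const_ratmx _).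
  have := tr0; rewrite PE (@invmx_eq _ _ _ (invmx Q *m const_ratmx (invmx P))).
    by rewrite /const_ratmx !mulmxA => /eqP; rewrite addrC addr_eq0 => /eqP.
  rewrite mulmxA mulmxK // -[LHS]map_mxM mulmxV //; exact: map_mx1.
have SS j : S j.+1 = const_ratmx 0.
  rewrite /const_ratmx map_mx0; elim: j => [|j IH].
    by have [] := step _ _ S0.
  by have [] := step j.+1 0; rewrite ?IH /const_ratmx ?map_mx0.
by move=> j; have [] := step _ _ (SS j).
Qed.

End Transfer.

(** Puts two realizations side by side, so that the comparison of two
    transfer functions becomes a statement about one. *)
Lemma difference_transfer (F : fieldType) (p q N1 N2 : nat)
    (P1 : 'M[F]_N1) (P2 : 'M[F]_N2) (C1 : 'M[F]_(p, N1)) (C2 : 'M[F]_(p, N2))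
    (B1 : 'M[F]_(N1, q)) (B2 : 'M[F]_(N2, q)) :
  \det P1 != 0 -> \det P2 != 0 ->
  row_mx C1 (- C2) *m invmx (block_mx P1 0 0 P2) *m col_mx B1 B2
    = C1 *m invmx P1 *m B1 - C2 *m invmx P2 *m B2.
Proof.
move=> d1 d2; rewrite invmx_block_diag; last first.
  by rewrite block_diag_mx_unit !unitmxE !unitfE d1.
rewrite mul_row_block !(mulmx0, addr0, add0r) mul_row_col.
by rewrite !mulNmx.
Qed.

Section Minimality.
Variable R : realType.

Lemma realizations_moments (m N1 N2 : nat) (G : 'M[ratfun R]_m)
    (E1 A1 : 'M[R]_N1) (B1 : 'M[R]_(N1, m)) (C1 : 'M[R]_(m, N1)) (D1 : 'M[R]_m)
    (E2 A2 : 'M[R]_N2) (B2 : 'M[R]_(N2, m)) (C2 : 'M[R]_(m, N2)) (D2 : 'M[R]_m) :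
  descriptor_realization G E1 A1 B1 C1 D1 ->
  descriptor_realization G E2 A2 B2 C2 D2 ->
  exists s : R, let P1 := s *: E1 - A1 in let P2 := s *: E2 - A2 in
    [/\ P1 \in unitmx, P2 \in unitmx &
     forall j, C1 *m (invmx P1 *m E1) ^+ j.+1 *m (invmx P1 *m B1)
             = C2 *m (invmx P2 *m E2) ^+ j.+1 *m (invmx P2 *m B2)].
Proof.
move=> [d1 G1] [d2 G2].
pose E := block_mx E1 0 0 E2; pose A := block_mx A1 0 0 A2.
have pE : zvar R *: const_ratmx E - const_ratmx A =
    block_mx (zvar R *: const_ratmx E1 - const_ratmx A1) 0 0
             (zvar R *: const_ratmx E2 - const_ratmx A2).
  rewrite /E /A /const_ratmx !map_block_mx !map_mx0 scale_block_mx !scaler0.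
  by rewrite opp_block_mx !oppr0 add_block_mx !addr0.
have sE (s : R) : s *: E - A = block_mx (s *: E1 - A1) 0 0 (s *: E2 - A2).
  by rewrite scale_block_mx !scaler0 opp_block_mx !oppr0 add_block_mx !addr0.
have d : \det (zvar R *: const_ratmx E - const_ratmx A) != 0.
  rewrite pE det_ublock; exact: (mulf_neq0 d1 d2).
have [s Pu] := pencil_regular_point d; exists s => P1 P2.
have [P1u P2u] : P1 \in unitmx /\ P2 \in unitmx.
  by apply/andP; rewrite -block_diag_mx_unit -sE.
split=> // j.
have := @constant_transfer_moments _ _ _ _ E A (col_mx B1 B2)
  (row_mx C1 (- C2)) (D1 - D2) s Pu.
rewrite pE sE -/P1 -/P2 => /(_ _ j).
have iP : invmx (block_mx P1 0 0 P2) = block_mx (invmx P1) 0 0 (invmx P2).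
  by rewrite invmx_block_diag // block_diag_mx_unit P1u.
rewrite iP /E mulmx_block mul_block_col !(mulmx0, mul0mx, addr0, add0r).
rewrite exp_block_diag mul_row_block !(mulmx0, mul0mx, addr0, add0r).
rewrite mul_row_col !mulNmx => h; apply/eqP; rewrite -subr_eq0; apply/eqP/h.
rewrite /const_ratmx map_row_mx map_col_mx map_mxB map_mxN.
rewrite (difference_transfer _ _ _ _ d1 d2) addrACA -opprD.
by apply/eqP; rewrite subr_eq0 -[X in X == _]G1 -[X in _ == X]G2.
Qed.

(** At a regular point s the nilpotent block contributes (s J - 1)^-1 J = -
    J because J^2 = 0, and the finite block contributes the resolvent of A1,
    so that [dimension_bound] applies. *)
Theorem weierstrass_realization_bound (m k r N : nat) (G : 'M[ratfun R]_m)
    (A1 : 'M[R]_k) (J : 'M[R]_r) (B1 : 'M[R]_(k, m)) (B2 : 'M[R]_(r, m))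
    (C1 : 'M[R]_(m, k)) (C2 : 'M[R]_(m, r)) (D : 'M[R]_m)
    (E' A' : 'M[R]_N) (B' : 'M[R]_(N, m)) (C' : 'M[R]_(m, N)) (D' : 'M[R]_m) :
  J *m J = 0 ->
  reachable A1 B1 -> reachable A1^T C1^T ->
  reachable J B2 -> reachable J^T C2^T ->
  descriptor_realization G (block_mx 1%:M 0 0 J) (block_mx A1 0 0 1%:M)
    (col_mx B1 B2) (row_mx C1 C2) D ->
  descriptor_realization G E' A' B' C' D' -> (k + 2 * \rank J <= N)%N.
Proof.
move=> JJ rB1 rC1 rB2 rC2 h0 h'.
have [s /= []] := realizations_moments h' h0.
set E0 := block_mx 1%:M 0 0 J; set A0 := block_mx A1 0 0 1%:M.
set P := s *: E0 - A0 => _ Pu h.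
have PE : P = block_mx (s%:M - A1) 0 0 (s *: J - 1%:M).
  by rewrite /P scale_block_mx !scaler0 opp_block_mx !oppr0 add_block_mx
    !addr0 scalemx1.
have := Pu; rewrite PE block_diag_mx_unit => /andP[P1u P2u].
have P2i : invmx (s *: J - 1%:M) = - (1%:M + s *: J).
  apply: invmx_eq; rewrite mulmxN mulmxDr mulmx1 mulmxBl mul1mx.
  rewrite -scalemxAr -scalemxAl JJ !scaler0 sub0r addrAC subrr sub0r opprK //.
have TE : invmx P *m E0 = block_mx (invmx (s%:M - A1)) 0 0 (- J).
  rewrite PE invmx_block_diag -?PE // P2i mulmx_block.
  rewrite !(mulmx0, mul0mx, addr0, add0r) mulmx1 mulNmx mulmxDl mul1mx.
  by rewrite -scalemxAl JJ scaler0 addr0.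
rewrite TE in h.
have JJN : - J *m - J = 0 by rewrite mulmxN mulNmx opprK.
rewrite -[in leqLHS](mxrank_opp J).
apply: (dimension_bound _ JJN _ _ h); first by rewrite unitmx_inv.
  apply: reachable_unit; rewrite ?unitmx_inv //.
    apply: reachable_block_diag; rewrite ?unitmx_inv //.
    - exact: reachable_resolvent.
    - exact: reachable_opp.
  rewrite -TE; have cPE : E0 *m P = P *m E0.
    rewrite mulmxBr mulmxBl -scalemxAr -scalemxAl !mulmx_block.
    by rewrite !(mulmx0, mul0mx, mulmx1, mul1mx, addr0, add0r).
  have e : invmx P *m E0 = E0 *m invmx P.
    by rewrite -[LHS](mulmxK Pu) -[invmx P *m E0 *m P]mulmxA cPE (mulKmx Pu).
  by rewrite -mulmxA -e.
rewrite tr_block_mx !trmx0 tr_row_mx.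
have -> : (invmx (s%:M - A1))^T = invmx (s%:M - A1^T).
  by rewrite trmx_inv linearB /= tr_scalar_mx.
apply: reachable_block_diag => //.
- rewrite unitmx_inv -unitmx_tr linearB /= tr_scalar_mx trmxK //.
- by rewrite -trmx_mul JJN trmx0.
- apply: reachable_resolvent => //.
  by rewrite -unitmx_tr linearB /= tr_scalar_mx trmxK.
by rewrite linearN; exact: reachable_opp.
Qed.

End Minimality.

Section WeierstrassTransfer.
Variable R : realType.

(** The determinant is the characteristic polynomial, which is monic. *)
Lemma resolvent_unit (n : nat) (A : 'M[R]_n) :
  (zvar R)%:M - const_ratmx A \in unitmx.
Proof.
have -> : (zvar R)%:M - const_ratmx A
    = map_mx (@FracField.tofrac _) (char_poly_mx (map_mx (real_complex R) A)).
  apply/matrixP => i j; rewrite !mxE tofracB; congr (_ - _).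
  by rewrite -mulr_natr -[in RHS]mulr_natr tofracM rmorph_nat.
rewrite unitmxE unitfE det_map_mx tofrac_eq0.
exact: (monic_neq0 (char_poly_monic _)).
Qed.

(** The nilpotent block is inverted by (z J - 1)^-1 = - (1 + z J). *)
Lemma weierstrass_transfer (m k r : nat) (A1 : 'M[R]_k) (J : 'M[R]_r)
    (B1 : 'M[R]_(k, m)) (B2 : 'M[R]_(r, m)) (C1 : 'M[R]_(m, k))
    (C2 : 'M[R]_(m, r))
    (P := zvar R *: const_ratmx (block_mx 1%:M 0 0 J)
          - const_ratmx (block_mx A1 0 0 1%:M)) :
  J *m J = 0 ->
  \det P != 0 /\
  const_ratmx (row_mx C1 C2) *m invmx P *m const_ratmx (col_mx B1 B2)
    = const_ratmx C1 *m invmx ((zvar R)%:M - const_ratmx A1) *m const_ratmx B1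
      - const_ratmx (C2 *m B2) - zvar R *: const_ratmx (C2 *m J *m B2).
Proof.
move=> JJ; have Ru := resolvent_unit A1.
have PE : P = block_mx ((zvar R)%:M - const_ratmx A1) 0 0
    (zvar R *: const_ratmx J - 1%:M).
  rewrite /P /const_ratmx !map_block_mx !map_mx0 !map_mx1 scale_block_mx.
  by rewrite !scaler0 opp_block_mx !oppr0 add_block_mx !addr0 scalemx1.
have JJL : const_ratmx J *m const_ratmx J = 0.
  by rewrite -[LHS]map_mxM JJ; exact: map_mx0.
have Ji : (zvar R *: const_ratmx J - 1%:M) *m - (1%:M + zvar R *: const_ratmx J)
    = 1%:M.
  move: (const_ratmx J) JJL => J' JJ'.
  rewrite mulmxN mulmxDr mulmx1 mulmxBl mul1mx.
  by rewrite -scalemxAr -scalemxAl JJ' !scaler0 sub0r addrAC subrr sub0r opprK.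
have [Ju _] := mulmx1_unit Ji.
have Pu : P \in unitmx by rewrite PE block_diag_mx_unit Ru Ju.
split; first by move: Pu; rewrite unitmxE unitfE.
rewrite PE invmx_block_diag -?PE // (invmx_eq Ji).
rewrite /const_ratmx map_row_mx map_col_mx !map_mxM -!/(const_ratmx _).
move: (const_ratmx C1) (const_ratmx C2) (const_ratmx B1) (const_ratmx B2).
move: (invmx _) (const_ratmx J) => X J' c1 c2 b1 b2.
rewrite mul_row_block !mulmx0 addr0 add0r mul_row_col -addrA; congr (_ + _).
by rewrite mulmxN mulmxDr mulmx1 mulNmx mulmxDl opprD -scalemxAr -scalemxAl.
Qed.

End WeierstrassTransfer.

(** * Inversion through the bordered resolvent *)

Section Inverse.
Variable (F : fieldType).

(** The component of xi in Im W is dictated by the constraint W^T xi = b.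
    Testing the first equation against Gam leaves a resolvent equation for
    the other component, and testing it against W determines w. *)
Lemma bordered_solution (N k p q : nat) (z : F) (S : 'M[F]_N)
    (W : 'M[F]_(N, p)) (Gam : 'M[F]_(N, k)) (Phii : 'M[F]_p) (Rs : 'M[F]_k)
    (a : 'M[F]_(N, q)) (b : 'M[F]_(p, q))
    (xi := Gam *m (Rs *m (Gam^T *m (a + S *m W *m Phii *m b))) + W *m Phii *m b)
    (w := Phii *m (z *: b - W^T *m S *m xi - W^T *m a)) :
  Gam^T *m Gam = 1%:M -> Gam^T *m W = 0 -> W^T *m W *m Phii = 1%:M ->
  Gam *m Gam^T + W *m Phii *m W^T = 1%:M ->
  (z%:M - Gam^T *m S *m Gam) *m Rs = 1%:M ->
  z *: xi - S *m xi - W *m w = a /\ W^T *m xi = b.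
Proof.
move=> GG GW WW GWI RsP.
have WG : W^T *m Gam = 0 by rewrite -[Gam]trmxK -trmx_mul GW trmx0.
have Wxi : W^T *m xi = b.
  by rewrite /xi mulmxDr !mulmxA WG !mul0mx add0r WW mul1mx.
split=> //.
have Gxi : Gam^T *m xi = Rs *m (Gam^T *m (a + S *m W *m Phii *m b)).
  by rewrite /xi mulmxDr !mulmxA GG GW !mul0mx addr0 mul1mx.
have Gpart : Gam^T *m (z *: xi - S *m xi - W *m w) = Gam^T *m a.
  rewrite !mulmxBr -scalemxAr Gxi !(mulmxA Gam^T W) GW mul0mx subr0.
  set v := Rs *m _.
  have -> : xi = Gam *m v + W *m Phii *m b by [].
  have : (z%:M - Gam^T *m S *m Gam) *m v = Gam^T *m (a + S *m W *m Phii *m b).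
    by rewrite /v !mulmxA RsP mul1mx.
  rewrite mulmxBl mul_scalar_mx !mulmxDr !mulmxA opprD addrA => ->.
  by rewrite addrK.
have Wpart : W^T *m (z *: xi - S *m xi - W *m w) = W^T *m a.
  rewrite !mulmxBr -scalemxAr Wxi /w !mulmxA WW mul1mx.
  by rewrite subKr.
rewrite -[LHS]mul1mx -[RHS]mul1mx -GWI !mulmxDl -!mulmxA Gpart.
by rewrite Wpart.
Qed.

Section Elimination.
Variables (n m1 m2 m3 q : nat) (z : F) (A : 'M[F]_n).
Variables (B1 : 'M[F]_(n, m1)) (B2 : 'M[F]_(n, m2)) (B3 : 'M[F]_(n, m3)).
Variables (D11 : 'M[F]_m1) (D12 : 'M[F]_(m1, m2)) (D13 : 'M[F]_(m1, m3)).
Variables (D22 D22i : 'M[F]_m2) (K1 K1i : 'M[F]_m1).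
Hypotheses (K1K : K1 *m K1i = 1%:M) (KK1 : K1i *m K1 = 1%:M)
  (DD : D22 *m D22i = 1%:M).

(** The matrix A~: the state matrix after elimination of u2 and rescaling of
    u1. *)
Definition state_matrix : 'M[F]_(n + m1) := block_mx
    (A - B2 *m D22i *m B2^T)
    ((B1 + B2 *m D22i *m D12^T) *m K1i)
    (K1i^T *m (- B1^T + D12 *m D22i *m B2^T))
    (- (K1i^T *m (D11 + D12 *m D22i *m D12^T) *m K1i)).

(** The matrix B~ Xi, where the orthogonal factor Xi^T of B~ has been
    undone: it cancels from A_inv and B_inv, and only rotates K_inv. *)
Definition border : 'M[F]_(n + m1, m3) := col_mx B3 (- (K1i^T *m D13)).

(** The right-hand side that f1 and f2 leave behind after the elimination of
    u2. *)
Definition source (f1 : 'M[F]_(m1, q)) (f2 : 'M[F]_(m2, q)) :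
  'M[F]_(n + m1, q) :=
  col_mx (B2 *m D22i *m f2) (K1i^T *m (f1 - D12 *m D22i *m f2)).

(** Undoes the elimination: u2 is chosen to satisfy its own equation,
    substituting it turns the first block row into the state equation, and
    multiplying the second block row by K1^T gives the equation for u1. *)
Lemma eliminated_system (xi : 'M[F]_(n + m1, q)) (u3 : 'M[F]_(m3, q))
    (f1 : 'M[F]_(m1, q)) (f2 : 'M[F]_(m2, q)) (f3 : 'M[F]_(m3, q))
    (x := usubmx xi) (u1 := K1i *m dsubmx xi)
    (u2 := D22i *m (f2 - B2^T *m x + D12^T *m u1)) :
  z *: xi - state_matrix *m xi - border *m u3 = source f1 f2 ->
  border^T *m xi = f3 ->
  [/\ z *: x - A *m x = B1 *m u1 + B2 *m u2 + B3 *m u3,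
      z *: (K1^T *m K1 *m u1) + D11 *m u1 + D12 *m u2 + D13 *m u3
        + B1^T *m x = f1,
      D22 *m u2 - D12^T *m u1 + B2^T *m x = f2
    & B3^T *m x - D13^T *m u1 = f3].
Proof.
rewrite -[xi]vsubmxK -/x /state_matrix /border /source.
set y := dsubmx xi in u1 u2 *.
rewrite mul_block_col mul_col_mx scale_col_mx !opp_col_mx !add_col_mx.
move=> /eq_col_mx[h1 h2]; rewrite tr_col_mx mul_row_col => h3; split.
- have := h1; rewrite /u2 !mulmxDr !mulmxBl !mulmxDl !mulmxN !mulmxA.
  rewrite -/u1 => /eqP; rewrite -subr_eq0 => /eqP h.
  rewrite -[RHS]addr0 -h /u1 ?mulmxA; mxlinear.
- have KK1t : K1^T *m K1i^T = 1%:M by rewrite -trmx_mul KK1 trmx1.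
  have := congr1 (mulmx K1^T) h2.
  rewrite !(mulmxDr, mulmxDl, mulmxBr, mulmxN, mulNmx, mulmxA) KK1t !mul1mx.
  rewrite -scalemxAr => /eqP; rewrite -subr_eq0 => /eqP h.
  rewrite -[RHS]addr0 -h /u2 /u1.
  rewrite -[K1^T *m K1 *m K1i]mulmxA K1K mulmx1. mxlinear.
- by rewrite mulmxA DD mul1mx; mxlinear.
- by rewrite -h3 trmxN mulNmx trmx_mul trmxK !mulmxA.
Qed.

Lemma tr_state_matrix : A^T = - A -> D11^T = - D11 -> D22i^T = - D22i ->
  state_matrix^T = - state_matrix.
Proof.
move=> hA hD11 hD22i; rewrite /state_matrix tr_block_mx opp_block_mx.
congr block_mx.
- rewrite trmxB !trmx_mul trmxK hA hD22i !(mulmxN, mulNmx, mulmxA); mxlinear.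
- rewrite !trmx_mul trmxD trmxN !trmx_mul !trmxK hD22i.
  by rewrite !(mulmxDr, mulmxDl, mulmxN, mulNmx, mulmxA); mxlinear.
- rewrite !trmx_mul trmxD !trmx_mul !trmxK hD22i.
  by rewrite !(mulmxDr, mulmxDl, mulmxN, mulNmx, mulmxA); mxlinear.
rewrite trmxN !trmx_mul trmxD !trmx_mul !trmxK hD22i hD11.
by rewrite !(mulmxDr, mulmxDl, mulmxN, mulNmx, mulmxA); mxlinear.
Qed.

End Elimination.

Section Inversion.
Variables (n m m1 m2 m3 k : nat) (A : 'M[F]_n) (B : 'M[F]_(n, m)).
Variables (M D : 'M[F]_m).
Variables (V1 : 'M[F]_(m, m1)) (V2 : 'M[F]_(m, m2)) (V3 : 'M[F]_(m, m3)).
Variables (D22i : 'M[F]_m2) (K1 K1i : 'M[F]_m1) (Phii : 'M[F]_m3).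
Variables (Gam : 'M[F]_(n + m1, k)).

Let S := state_matrix A (B *m V1) (B *m V2)
  (V1^T *m D *m V1) (V1^T *m D *m V2) D22i K1i.
Let W := border (B *m V3) (V1^T *m D *m V3) K1i.
Let a := source (B *m V2) (V1^T *m D *m V2) D22i K1i V1^T V2^T.

(** The matrix B_inv in coordinate-free form. *)
Definition inverse_input : 'M[F]_(k, m) :=
  Gam^T *m (a + S *m W *m Phii *m V3^T).

(** The matrix D_inv in coordinate-free form. *)
Definition inverse_feedthrough : 'M[F]_m :=
  V2 *m D22i *m V2^T + a^T *m W *m Phii *m V3^T - V3 *m Phii *m W^T *m a
  - V3 *m Phii *m (W^T *m S *m W) *m Phii *m V3^T.

Hypotheses (hA : A^T = - A) (hM : M^T = M) (hD : D^T = - D)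
  (hV : V1 *m V1^T + V2 *m V2^T + V3 *m V3^T = 1%:M)
  (hMV2 : M *m V2 = 0) (hMV3 : M *m V3 = 0)
  (hV2DV3 : V2^T *m D *m V3 = 0) (hV3DV3 : V3^T *m D *m V3 = 0).
Hypotheses (hM1 : K1^T *m K1 = V1^T *m M *m V1)
  (K1K : K1 *m K1i = 1%:M) (KK1 : K1i *m K1 = 1%:M)
  (hD22i : D22i^T = - D22i) (DD : V2^T *m D *m V2 *m D22i = 1%:M).
Hypotheses (PP : Phii^T = Phii) (WW : W^T *m W *m Phii = 1%:M)
  (GG : Gam^T *m Gam = 1%:M) (GW : Gam^T *m W = 0)
  (GWI : Gam *m Gam^T + W *m Phii *m W^T = 1%:M).

(** Applying the right-hand factor to f yields u = V1 u1 + V2 u2 + V3 u3,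
    with u1, u2, u3 from the bordered system with f_i = V_i^T f; then B u =
    (z - A) x, and the remaining equations say that the components of F u
    are those of f. The skew symmetry of S makes the output map of the
    inverse the transpose of B_inv. *)
Theorem pro_function_inverse (z : F) (Rs : 'M[F]_k) :
  z%:M - A \in unitmx -> (z%:M - Gam^T *m S *m Gam) *m Rs = 1%:M ->
  (z *: M + D + B^T *m invmx (z%:M - A) *m B)
    *m (inverse_feedthrough + z *: (V3 *m Phii *m V3^T)
        + inverse_input^T *m Rs *m inverse_input) = 1%:M.
Proof.
move=> zAu RsP; set G := _ + _ *m inverse_input.
set xi := Gam *m (Rs *m inverse_input) + W *m Phii *m V3^T.
set u3 := Phii *m (z *: V3^T - W^T *m S *m xi - W^T *m a).
have [] := bordered_solution (W := W) (Phii := Phii) (Gam := Gam) (Rs := Rs)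
  (S := S) (z := z) a V3^T GG GW WW GWI RsP.
rewrite -/(inverse_input) -/xi -/u3 => e1 e2.
have [] := eliminated_system K1K KK1 DD e1 e2.
set x := usubmx xi; set u1 := K1i *m _; set u2 := D22i *m _.
move=> E0 E1 E2 E3.
have Sskew : S^T = - S.
  apply: tr_state_matrix => //.
  by rewrite !trmx_mul trmxK hD mulNmx mulmxN mulmxA.
have aE : a^T *m xi = V1 *m u1 + V2 *m u2 - V2 *m D22i *m V2^T.
  rewrite -[xi]vsubmxK /a /source tr_col_mx mul_row_col -/x.
  rewrite /u2 /u1.
  rewrite !(trmx_mul, trmxB, trmxK, hD, hD22i, mulmxDr, mulmxDl, mulmxN,
    mulNmx, mulmxA).
  mxlinear.
have GE : G = V1 *m u1 + V2 *m u2 + V3 *m u3.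
  have -> : V1 *m u1 + V2 *m u2 = a^T *m xi + V2 *m D22i *m V2^T.
    by rewrite aE subrK.
  have iT : inverse_input^T = (a^T - V3 *m Phii *m W^T *m S) *m Gam.
    rewrite /inverse_input trmx_mul trmxK; congr (_ *m _).
    by rewrite trmxD !trmx_mul trmxK PP Sskew !(mulmxN, mulNmx, mulmxA).
  rewrite /G iT /u3 /xi /inverse_feedthrough.
  rewrite !(mulmxDr, mulmxDl, mulmxN, mulNmx, mulmxA) -!scalemxAr.
  mxlinear.
have BG : B *m G = (z%:M - A) *m x.
  by rewrite mulmxBl mul_scalar_mx E0 GE !mulmxDr !mulmxA.
rewrite !mulmxDl -scalemxAl -2!mulmxA BG (mulKmx zAu).
(* Only the equations E0 to E3 on x, u1, u2, u3 matter below. *)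
clear aE; clearbody G u3 u2 u1 x.
have V2M : V2^T *m M = 0 by rewrite -hM -trmx_mul hMV2 trmx0.
have V3M : V3^T *m M = 0 by rewrite -hM -trmx_mul hMV3 trmx0.
have V2DV1 : V2^T *m D *m V1 = - (V1^T *m D *m V2)^T.
  by rewrite !trmx_mul trmxK hD mulNmx mulmxN opprK mulmxA.
have V3DV1 : V3^T *m D *m V1 = - (V1^T *m D *m V3)^T.
  by rewrite !trmx_mul trmxK hD mulNmx mulmxN opprK mulmxA.
have V3DV2 : V3^T *m D *m V2 = 0.
  apply: trmx_inj; rewrite !trmx_mul trmxK hD mulNmx mulmxN mulmxA hV2DV3.
  by rewrite oppr0 trmx0.
set X := _ + _.
have P1 : V1^T *m X = V1^T.
  rewrite -[RHS]E1 /X GE hM1 !(mulmxDr, mulmxA) -!scalemxAr.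
  rewrite !(mulmxDr, mulmxA) -[V1^T *m M *m V2]mulmxA hMV2.
  rewrite -[V1^T *m M *m V3]mulmxA hMV3 !mulmx0 !mul0mx trmx_mul.
  by mxlinear.
have P2 : V2^T *m X = V2^T.
  rewrite -[RHS]E2 /X GE !(mulmxDr, mulmxA) -!scalemxAr.
  rewrite !(mulmxDr, mulmxA) V2M !mul0mx hV2DV3 V2DV1 mul0mx (trmx_mul B) !mulNmx.
  by mxlinear.
have P3 : V3^T *m X = V3^T.
  rewrite -[RHS]E3 /X GE !(mulmxDr, mulmxA) -!scalemxAr.
  rewrite !(mulmxDr, mulmxA) V3M !mul0mx hV3DV3 V3DV2 V3DV1 !mul0mx.
  rewrite (trmx_mul B) !mulNmx.
  by mxlinear.
by rewrite -[LHS]mul1mx -hV !mulmxDl -!mulmxA P1 P2 P3.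
Qed.

Hypotheses (V11 : V1^T *m V1 = 1%:M) (V22 : V2^T *m V2 = 1%:M)
  (V33 : V3^T *m V3 = 1%:M) (V12 : V1^T *m V2 = 0) (V13 : V1^T *m V3 = 0)
  (V23 : V2^T *m V3 = 0).

(** Let U be stable and kill B_inv, and let Y = U Gam^T = [Y1 Y2].
    Multiplying U B_inv = 0 by V1, V2, V3 gives Y2 = 0, Y1 B V2 = 0 and Y S
    W = 0; the last makes the space Y stable under S itself and not only
    under its compression, and then Y2 = 0 forces Y1 B V1 = 0 and the
    stability of Y1 under A. Finally Y1 B V3 = 0 because Gam is orthogonal
    to W. *)
Theorem reachable_inverse :
  reachable A B -> reachable (Gam^T *m S *m Gam) inverse_input.
Proof.
move=> rAB p U /submxP[Z UZ]; rewrite /inverse_input mulmxA => UI.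
have V21 : V2^T *m V1 = 0 by rewrite -[V1]trmxK -trmx_mul V12 trmx0.
have V31 : V3^T *m V1 = 0 by rewrite -[V1]trmxK -trmx_mul V13 trmx0.
have V32 : V3^T *m V2 = 0 by rewrite -[V2]trmxK -trmx_mul V23 trmx0.
have aV q (V : 'M[F]_(m, q)) : a *m V
    = source (B *m V2) (V1^T *m D *m V2) D22i K1i (V1^T *m V) (V2^T *m V).
  by rewrite /a /source mul_col_mx !(mulmxBl, mulmxA, mulmxBr).
pose Y := U *m Gam^T; pose Y1 := lsubmx Y; pose Y2 := rsubmx Y.
have YE : Y = row_mx Y1 Y2 by rewrite hsubmxK.
have YV q (V : 'M[F]_(m, q)) :
    Y *m (a *m V) + Y *m S *m W *m Phii *m (V3^T *m V) = 0.
  have := congr1 (mulmxr V) UI.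
  by rewrite /= mul0mx mulmxDr mulmxDl !mulmxA.
have PW : Phii *m (W^T *m W) = 1%:M by apply: mulmx1C.
have D22iD : D22i *m (V2^T *m D *m V2) = 1%:M by apply: mulmx1C.
have YSW : Y *m S *m W = 0.
  have := YV _ V3; rewrite aV V13 V23 V33 /source !mulmx0 subr0 mulmx0 col_mx0.
  rewrite mulmx0 add0r mulmx1 => h.
  by rewrite -[LHS]mulmx1 -PW mulmxA h mul0mx.
have Y20 : Y2 = 0.
  have := YV _ V1; rewrite aV V11 V21 YSW !mul0mx addr0 /source !mulmx0 subr0.
  rewrite mulmx1 YE mul_row_col mulmx0 add0r => h.
  by rewrite -[LHS]mulmx1 -trmx1 -K1K trmx_mul mulmxA h mul0mx.
rewrite Y20 in YE.
have Y1B2 : Y1 *m (B *m V2) = 0.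
  have := YV _ V2; rewrite aV V12 V22 YSW !mul0mx addr0 /source YE mul_row_col.
  rewrite mul0mx addr0 mulmx1 mulmxA => h.
  by rewrite -[LHS]mulmx1 -D22iD mulmxA h mul0mx.
have Y1B3 : Y1 *m (B *m V3) = 0.
  have : Y *m W = 0 by rewrite /Y -mulmxA GW mulmx0.
  by rewrite YE /W /border mul_row_col mul0mx addr0.
have YS : Y *m S = Z *m Y.
  have := congr1 (mulmxr Gam^T) UZ; rewrite /= -[Z *m U *m _]mulmxA -/Y => <-.
  rewrite -[LHS]mulmx1 -GWI mulmxDr [X in _ + X]mulmxA [X in _ + X *m _]mulmxA.
  by rewrite YSW !mul0mx addr0 /Y !mulmxA.
move: YS; rewrite YE mul_row_block mul_mx_row mulmx0 !mul0mx !addr0.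
move=> /eq_row_mx[Y1A]; rewrite mulmxA mulmxDr !mulmxA -[Y1 *m B *m V2]mulmxA.
rewrite Y1B2 !mul0mx addr0 => Y1B1.
have Y10 : Y1 = 0.
  apply: rAB.
    move: Y1A; rewrite mulmxBr !mulmxA -[Y1 *m B *m V2]mulmxA Y1B2 !mul0mx subr0.
    by move=> ->; rewrite submxMl.
  rewrite -[LHS]mulmx1 -hV !mulmxDr !mulmxA -[Y1 *m B *m V2]mulmxA Y1B2.
  rewrite -[Y1 *m B *m V3]mulmxA Y1B3 !mul0mx !addr0.
  by rewrite -[Y1 *m B *m V1]mulmx1 -KK1 mulmxA Y1B1 !mul0mx.
by rewrite -[LHS]mulmx1 -GG mulmxA -/Y YE Y10 row_mx0 mul0mx.
Qed.

End Inversion.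
End Inverse.

(** * Block formulas for the realization of the inverse *)

Section BlockFormulas.
Variables (F : fieldType) (n m m1 m2 m3 k : nat) (A : 'M[F]_n).
Variables (B : 'M[F]_(n, m)) (D : 'M[F]_m).
Variables (V1 : 'M[F]_(m, m1)) (V2 : 'M[F]_(m, m2)) (V3 : 'M[F]_(m, m3)).
Variables (D22i : 'M[F]_m2) (K1i : 'M[F]_m1) (Phii : 'M[F]_m3).
Variables (Gam : 'M[F]_(n + m1, k)).

Let V := row3 V1 V2 V3.
Let B1 := B *m V1.
Let B2 := B *m V2.
Let B3 := B *m V3.
Let D11 := V1^T *m D *m V1.
Let D12 := V1^T *m D *m V2.
Let D13 := V1^T *m D *m V3.
Let M1i := K1i *m K1i^T.
Let Phi23 := B2^T *m B3 + D12^T *m M1i *m D13.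
Let S := state_matrix A B1 B2 D11 D12 D22i K1i.
Let W := border B3 D13 K1i.

Let SW : S *m W = col_mx
  (A *m B3 - B1 *m M1i *m D13 - B2 *m D22i *m Phi23)
  (- (K1i^T *m (B1^T *m B3 - D11 *m M1i *m D13 - D12 *m D22i *m Phi23))).
Proof.
rewrite /S /W /state_matrix /border mul_block_col.
rewrite /Phi23 /M1i; move: B1 B2 B3 D11 D12 D13 => b1 b2 b3 d11 d12 d13.
congr col_mx.
  rewrite !(mulmxDr, mulmxDl, mulmxN, mulNmx, mulmxA); mxlinear.
rewrite !(mulmxDr, mulmxDl, mulmxN, mulNmx, mulmxA); mxlinear.
Qed.

Lemma inverse_inputE : inverse_input A B D V1 V2 V3 D22i K1i Phii Gam =
  Gam^T *m col_mx
    (row3 0 (B2 *m D22i)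
      ((A *m B3 - B1 *m M1i *m D13 - B2 *m D22i *m Phi23) *m Phii))
    (row3 (K1i^T) (- (K1i^T *m D12 *m D22i))
      (- (K1i^T *m (B1^T *m B3 - D11 *m M1i *m D13 - D12 *m D22i *m Phi23)
          *m Phii))) *m V^T.
Proof.
rewrite /inverse_input -/B1 -/B2 -/B3 -/D11 -/D12 -/D13 -/S -/W SW.
rewrite -[RHS]mulmxA; congr (_ *m _).
rewrite !mul_col_mx /V !row3_mul_tr mul0mx add0r /source add_col_mx.
congr col_mx; rewrite mulmxBr !mulNmx !mulmxA //.
Qed.

Lemma inverse_feedthroughE (SWW := W^T *m S *m W) : D22i^T = - D22i ->
  inverse_feedthrough A B D V1 V2 V3 D22i K1i Phii =
  V *m col3
    (row3 0 0 (- (M1i *m D13 *m Phii)))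
    (row3 0 D22i (- (D22i *m Phi23 *m Phii)))
    (row3 (Phii *m D13^T *m M1i) (- (Phii *m Phi23^T *m D22i))
          (- (Phii *m SWW *m Phii))) *m V^T.
Proof.
move=> hD22i; rewrite /inverse_feedthrough -/B1 -/B2 -/B3 -/D11 -/D12 -/D13.
rewrite -/S -/W -/SWW; set a := source _ _ _ _ _ _.
have aW : a^T *m W = - (V1 *m M1i *m D13) - V2 *m D22i *m Phi23.
  rewrite /a /W /source /border tr_col_mx mul_row_col.
  rewrite /Phi23 /M1i; move: B2 B3 D12 D13 => b2 b3 d12 d13.
  rewrite !(trmx_mul, trmxB, trmxK, hD22i, mulmxDr, mulmxDl, mulmxN, mulNmx,
    mulmxA).
  by mxlinear.
have Wa : W^T *m a = - (D13^T *m M1i *m V1^T) + Phi23^T *m D22i *m V2^T.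
  apply: trmx_inj; rewrite trmx_mul trmxK aW /M1i trmxD trmxN !trmx_mul !trmxK.
  by rewrite hD22i !(mulmxN, mulNmx, mulmxA).
rewrite -[in RHS]mulmxA col3_mul !row3_mul_tr row3_mul_col3 aW.
rewrite -(mulmxA _ W^T a) Wa; move: Phi23 => Phi23'.
by rewrite !(mulmxDr, mulmxDl, mulmxN, mulNmx, mulmxA, mul0mx, mulmx0); mxlinear.
Qed.

Lemma border_quadratic :
  W^T *m S *m W = B3^T *m A *m B3 - B3^T *m B1 *m M1i *m D13
            + D13^T *m M1i *m B1^T *m B3
            - D13^T *m M1i *m D11 *m M1i *m D13
            - Phi23^T *m D22i *m Phi23.
Proof.
have -> : Phi23^T = B3^T *m B2 + D13^T *m M1i *m D12.
  rewrite /Phi23 /M1i; move: B2 B3 D12 D13 => b2 b3 d12 d13.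
  by rewrite trmxD !trmx_mul !trmxK !mulmxA.
rewrite -mulmxA SW /W /border tr_col_mx mul_row_col.
move: Phi23 B1 B2 B3 D11 D12 D13 => phi23 b1 b2 b3 d11 d12 d13; rewrite /M1i.
rewrite trmxN trmx_mul trmxK.
rewrite !(mulmxDr, mulmxDl, mulmxN, mulNmx, mulmxA); mxlinear.
Qed.

Lemma border_gram : W^T *m W = B3^T *m B3 + D13^T *m M1i *m D13.
Proof.
rewrite /W /border tr_col_mx mul_row_col trmxN mulNmx mulmxN opprK.
by rewrite (trmx_mul K1i^T) trmxK !mulmxA.
Qed.

End BlockFormulas.

Section Mapping.
Variables (F L : fieldType) (f : {rmorphism F -> L}).
Variables (n m m1 m2 m3 k : nat).
Local Notation "X ^f" := (map_mx f X) : ring_scope.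

Lemma map_state_matrix (A : 'M[F]_n) (B1 : 'M[F]_(n, m1)) (B2 : 'M[F]_(n, m2))
    (D11 : 'M[F]_m1) (D12 : 'M[F]_(m1, m2)) (D22i : 'M[F]_m2) (K1i : 'M[F]_m1) :
  (state_matrix A B1 B2 D11 D12 D22i K1i)^f
    = state_matrix A^f B1^f B2^f D11^f D12^f D22i^f K1i^f.
Proof.
by rewrite /state_matrix map_block_mx
  !(map_mxB, map_mxN, map_mxM, map_mxD) -!map_trmx.
Qed.

Lemma map_border (B3 : 'M[F]_(n, m3)) (D13 : 'M[F]_(m1, m3)) (K1i : 'M[F]_m1) :
  (border B3 D13 K1i)^f = border B3^f D13^f K1i^f.
Proof. by rewrite /border map_col_mx !(map_mxN, map_mxM) -!map_trmx. Qed.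

Lemma map_source (q : nat) (B2 : 'M[F]_(n, m2)) (D12 : 'M[F]_(m1, m2))
    (D22i : 'M[F]_m2) (K1i : 'M[F]_m1) (f1 : 'M[F]_(m1, q)) (f2 : 'M[F]_(m2, q)) :
  (source B2 D12 D22i K1i f1 f2)^f
    = source B2^f D12^f D22i^f K1i^f f1^f f2^f.
Proof. by rewrite /source map_col_mx !(map_mxB, map_mxM) -!map_trmx. Qed.

Lemma map_inverse_input (A : 'M[F]_n) (B : 'M[F]_(n, m)) (D : 'M[F]_m)
  (V1 : 'M[F]_(m, m1)) (V2 : 'M[F]_(m, m2)) (V3 : 'M[F]_(m, m3))
  (D22i : 'M[F]_m2) (K1i : 'M[F]_m1) (Phii : 'M[F]_m3)
  (Gam : 'M[F]_(n + m1, k)) :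
  (inverse_input A B D V1 V2 V3 D22i K1i Phii Gam)^f
  = inverse_input A^f B^f D^f V1^f V2^f V3^f D22i^f K1i^f Phii^f Gam^f.
Proof.
rewrite /inverse_input !(map_mxM, map_mxD, map_state_matrix, map_border).
by rewrite map_source !map_mxM -!map_trmx.
Qed.

Lemma map_inverse_feedthrough (A : 'M[F]_n) (B : 'M[F]_(n, m)) (D : 'M[F]_m)
  (V1 : 'M[F]_(m, m1)) (V2 : 'M[F]_(m, m2)) (V3 : 'M[F]_(m, m3))
  (D22i : 'M[F]_m2) (K1i : 'M[F]_m1) (Phii : 'M[F]_m3) :
  (inverse_feedthrough A B D V1 V2 V3 D22i K1i Phii)^f
  = inverse_feedthrough A^f B^f D^f V1^f V2^f V3^f D22i^f K1i^f Phii^f.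
Proof.
rewrite /inverse_feedthrough !(map_mxB, map_mxD, map_mxM) -!map_trmx.
by rewrite !(map_state_matrix, map_border, map_source) !map_mxM -!map_trmx.
Qed.
End Mapping.

(** * The minimal Weierstrass realization *)

Theorem theorem5p5 (R : realType) (m n : nat)
    (M D : 'M[R]_m) (B : 'M[R]_(n, m)) (A : 'M[R]_n)
    (hM : psdmx M) (hA : A^T = - A) (hD : D^T = - D)
    (hAB : controllable A B)
    (hF : PRO (pro_function M D B A))
    (m1 m2 m3 : nat)
    (V1 : 'M[R]_(m, m1)) (V2 : 'M[R]_(m, m2)) (V3 : 'M[R]_(m, m3))
    (hV1 : orthonormal_basis (subX1 M) V1)
    (hV2 : orthonormal_basis (subX2 M D) V2)
    (hV3 : orthonormal_basis (subX3 M D) V3)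
    (K1 : 'M[R]_m1) (hK1 : K1^T *m K1 = V1^T *m M *m V1)
    (Xi : 'M[R]_m3) (hXi : Xi^T *m Xi = 1%:M)
    (k : nat) (hk : k = (n + m1 - m3)%N) (Gam : 'M[R]_(n + m1, k)) :
  let F := pro_function M D B A in
  (* blocks with respect to R^m = X1 + X2 + X3 *)
  let V := row3 V1 V2 V3 in
  let B1 := B *m V1 in
  let B2 := B *m V2 in
  let B3 := B *m V3 in
  let D11 := V1^T *m D *m V1 in
  let D12 := V1^T *m D *m V2 in
  let D13 := V1^T *m D *m V3 in
  let D22 := V2^T *m D *m V2 in
  let M1 := V1^T *m M *m V1 in
  let D22i := invmx D22 in
  let M1i := invmx M1 in
  let K1i := invmx K1 in
  let At : 'M[R]_(n + m1) := block_mx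
    (A - B2 *m D22i *m B2^T)
    ((B1 + B2 *m D22i *m D12^T) *m K1i)
    (K1i^T *m (- B1^T + D12 *m D22i *m B2^T))
    (- (K1i^T *m (D11 + D12 *m D22i *m D12^T) *m K1i)) in
  let Bt : 'M[R]_(n + m1, m3) := col_mx
    (B3 *m Xi^T)
    (- (K1i^T *m D13 *m Xi^T)) in
  forall (hBt : kerc Bt = 0)
    (hGam : Gam^T *m Gam = 1%:M) (hGamBt : (Gam^T <= orthc Bt^T)%MS),
  let Phi33 := B3^T *m B3 + D13^T *m M1i *m D13 in
  let Phi23 := B2^T *m B3 + D12^T *m M1i *m D13 in
  let Phi33i := invmx Phi33 in
  let Phi33isqrt := invmx (psd_sqrt Phi33) in
  let BAB := Xi^T *m Bt^T *m At *m Bt *m Xi in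
  let Ainv := Gam^T *m At *m Gam in
  let Kinv := row3 0 0 (- (Xi *m Phi33isqrt)) *m V^T in
  let Binv := Gam^T *m col_mx
    (row3 0
          (B2 *m D22i)
          ((A *m B3 - B1 *m M1i *m D13 - B2 *m D22i *m Phi23) *m Phi33i))
    (row3 (K1i^T)
          (- (K1i^T *m D12 *m D22i))
          (- (K1i^T *m (B1^T *m B3 - D11 *m M1i *m D13 - D12 *m D22i *m Phi23)
              *m Phi33i))) *m V^T in
  let E0 : 'M[R]_(k + (m3 + m3)) := col3
    (row3 1%:M 0 0)
    (row3 0    0 1%:M)
    (row3 0    0 0) in
  let A0 : 'M[R]_(k + (m3 + m3)) := col3
    (row3 Ainv 0    0)
    (row3 0    1%:M 0)
    (row3 0    0    1%:M) in
  let B0 : 'M[R]_(k + (m3 + m3), m) := col3 Binv 0 (- Kinv) in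
  let C0 : 'M[R]_(k + (m3 + m3), m) := col3 Binv Kinv 0 in
  let D0 : 'M[R]_m := V *m col3
    (row3 0
          0
          (- (M1i *m D13 *m Phi33i)))
    (row3 0
          D22i
          (- (D22i *m Phi23 *m Phi33i)))
    (row3 (Phi33i *m D13^T *m M1i)
          (- (Phi33i *m Phi23^T *m D22i))
          (- (Phi33i *m BAB *m Phi33i))) *m V^T in
  [/\ (* the inverses in the formulas are genuine inverses *)
      [/\ M1 \in unitmx, D22 \in unitmx, K1 \in unitmx & Phi33 \in unitmx],
      \det F != 0,
      minimal_descriptor_realization (invmx F) E0 A0 B0 C0^T D0,
      weierstrass_form E0 A0
    & BAB = B3^T *m A *m B3 - B3^T *m B1 *m M1i *m D13
            + D13^T *m M1i *m B1^T *m B3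
            - D13^T *m M1i *m D11 *m M1i *m D13
            - Phi23^T *m D22i *m Phi23].
Proof.
move=> F V B1 B2 B3 D11 D12 D13 D22 M1 D22i M1i K1i At Bt hBt hGam hGamBt.
move=> Phi33 Phi23 Phi33i Phi33isqrt BAB Ainv Kinv Binv E0 A0 B0 C0 D0.
have Msym := hM.1.
have M1u : M1 \in unitmx by exact: M_block11_unit Msym hV1.
have D22u : D22 \in unitmx by exact: D_block22_unit hV1 hV2 hV3.
have K1u : K1 \in unitmx.
  have : K1^T *m K1 \in unitmx by rewrite hK1.
  by rewrite unitmx_mul => /andP[].
have M1iE : M1i = K1i *m K1i^T.
  apply: invmx_eq; rewrite /M1 -hK1 mulmxA -(mulmxA K1^T) mulmxV // mulmx1.
  by rewrite -trmx_mul mulVmx // trmx1.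
pose W := border B3 D13 K1i.
have AtE : At = state_matrix A B1 B2 D11 D12 D22i K1i by [].
have BtE : Bt = W *m Xi^T by rewrite /W /border mul_col_mx mulNmx.
have WE : W = Bt *m Xi by rewrite BtE -mulmxA hXi mulmx1.
have Phi33E : Phi33 = W^T *m W by rewrite /W border_gram /Phi33 M1iE.
have Btf : row_free Bt^T by rewrite -kermx_eq0; apply/eqP.
have Phi33u : Phi33 \in unitmx.
  apply: unitmx_row0 => x; rewrite Phi33E mulmxA => h.
  have xW : x *m W^T = 0.
    apply: trmx_inj; rewrite trmx0; apply: gram_eq0.
    by rewrite trmxK trmx_mul trmxK mulmxA h mul0mx.
  have xXi : x *m Xi^T = 0.
    apply/eqP; rewrite -(mulmx_free_eq0 _ Btf) -mulmxA -trmx_mul -WE.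
    by rewrite xW.
  by rewrite -[x]mulmx1 -hXi mulmxA xXi mul0mx.
have Phi33sym : Phi33^T = Phi33 by rewrite Phi33E trmx_mul trmxK.
have Phi33psd : psdmx Phi33.
  split=> // x; rewrite Phi33E mulmxA -trmx_mul -mulmxA; exact: gram_ge0.
have [[Qsym _] QQ] := psd_sqrtP Phi33psd.
have Qu : psd_sqrt Phi33 \in unitmx.
  by have := Phi33u; rewrite -{1}QQ unitmx_mul => /andP[].
have hkN : (k + m3)%N = (n + m1)%N.
  rewrite hk subnK //; move/eqP: Btf => {1}<-; exact: rank_leq_col.
have GW : Gam^T *m W = 0.
  move: hGamBt; rewrite sub_orthc trmxK => /eqP GB.
  by rewrite WE mulmxA GB mul0mx.
have WW : W^T *m W *m Phi33i = 1%:M by rewrite -Phi33E mulmxV.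
have GWI := complementary_projections hkN hGam GW WW.
have DD : D22 *m D22i = 1%:M by rewrite mulmxV.
have K1K : K1 *m K1i = 1%:M by rewrite mulmxV.
have KK1 : K1i *m K1 = 1%:M by rewrite mulVmx.
have D22iT : D22i^T = - D22i.
  rewrite trmx_inv; apply: invmx_eq.
  by rewrite /D22 !(trmx_mul, trmxK, hD, mulmxN, mulNmx, opprK, mulmxA) DD.
have PP : Phi33i^T = Phi33i by rewrite trmx_inv Phi33sym.
have BABE : BAB = W^T *m At *m W.
  by rewrite WE trmx_mul !mulmxA.
have BinvE : Binv = inverse_input A B D V1 V2 V3 D22i K1i Phi33i Gam.
  by rewrite inverse_inputE -M1iE.
have D0E : D0 = inverse_feedthrough A B D V1 V2 V3 D22i K1i Phi33i.
  by rewrite inverse_feedthroughE; [rewrite -M1iE /D0 BABE | exact: D22iT].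
have KinvE : Kinv = - (Xi *m Phi33isqrt *m V3^T).
  by rewrite /Kinv row3_mul_tr !mul0mx !add0r mulNmx.
have sumV := sum_orthogonal_projections hV1 hV2 hV3.
have JJ := jordan2_sq0 R m3.
have E0E : E0 = block_mx 1%:M 0 0 (jordan2 R m3) by exact: col3_row3_diag.
have A0E : A0 = block_mx Ainv 0 0 1%:M.
  by rewrite [LHS]col3_row3_diag -scalar_mx_block.
have V11 := hV1.1; have V22 := hV2.1; have V33 := hV3.1.
have V12 := X1_orthogonal_X2 hV1 hV2; have V13 := X1_orthogonal_X3 hV1 hV3.
have V23 := X2_orthogonal_X3 hV2 hV3.
have hMV2 := M_annihilates_X2 hV2; have hMV3 := M_annihilates_X3 hV3.
have d23 := D_block23_eq0 hD hV2 hV3; have d33 := D_block33_eq0 hD hV3.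
have Atskew : At^T = - At.
  apply: tr_state_matrix => //.
  by rewrite !trmx_mul trmxK hD mulNmx mulmxN mulmxA.
have Ainvskew : Ainv^T = - Ainv.
  by rewrite /Ainv !trmx_mul trmxK Atskew mulNmx mulmxN mulmxA.
have rB : reachable Ainv Binv.
  rewrite BinvE; apply: (reachable_inverse (K1 := K1)) => //.
  exact: reachable_of_controllable.
have Kfree : row_free Kinv.
  apply/row_freeP; exists (- (V3 *m psd_sqrt Phi33 *m Xi^T)).
  rewrite KinvE mulNmx mulmxN opprK !mulmxA -(mulmxA _ V3^T) V33 mulmx1.
  by rewrite -(mulmxA Xi) mulVmx // mulmx1; apply: mulmx1C.
(* The polynomial part z K_inv^T K_inv, where Xi cancels. *)
have KK : Kinv^T *m Kinv = V3 *m Phi33i *m V3^T.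
  rewrite KinvE trmxN mulNmx mulmxN opprK !trmx_mul trmxK trmx_inv Qsym.
  rewrite !mulmxA -(mulmxA _ Xi^T) hXi mulmx1.
  congr (_ *m _); rewrite -mulmxA; congr (_ *m _).
  apply/esym/invmx_eq; rewrite -{1}QQ !mulmxA -(mulmxA (psd_sqrt _)).
  by rewrite mulmxV // mulmx1 mulmxV.
have FG : F *m (const_ratmx D0 + zvar R *: const_ratmx (V3 *m Phi33i *m V3^T)
    + const_ratmx Binv^T *m invmx ((zvar R)%:M - const_ratmx Ainv)
      *m const_ratmx Binv) = 1%:M.
  rewrite D0E BinvE /F /pro_function /const_ratmx -!map_trmx.
  rewrite map_inverse_feedthrough map_inverse_input.
  rewrite (map_mxM _ (V3 *m _)) (map_mxM _ V3) -map_trmx.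
  apply: (pro_function_inverse (K1 := map_mx (@const_ratfun R) K1)).
  (* Every hypothesis is the image of an identity between real matrices. *)
  all: rewrite ?map_trmx -?map_mxM -?map_border -?map_state_matrix ?map_trmx.
  all: rewrite -?map_mxM -?map_mxD -?map_mxN.
  all: rewrite ?(hA, Msym, hD, sumV, hMV2, hMV3, d23, d33, hK1, K1K, KK1).
  all: rewrite ?(D22iT, DD, PP, WW, hGam, GW, GWI) ?map_mxN ?map_mx1 ?map_mx0.
  all: try reflexivity.
    exact: resolvent_unit.
  exact: mulmxV (resolvent_unit _).
have C0E : C0^T = row_mx Binv^T (row_mx Kinv^T 0).
  by rewrite /C0 /col3 !tr_col_mx trmx0.
have [P0 tr] := weierstrass_transfer Ainv Binv (col_mx 0 (- Kinv)) Binv^T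
  (row_mx Kinv^T 0) JJ.
have G0 : const_ratmx D0 + const_ratmx C0^T
      *m invmx (zvar R *: const_ratmx E0 - const_ratmx A0) *m const_ratmx B0
    = const_ratmx D0 + zvar R *: const_ratmx (V3 *m Phi33i *m V3^T)
      + const_ratmx Binv^T *m invmx ((zvar R)%:M - const_ratmx Ainv)
        *m const_ratmx Binv.
  rewrite E0E A0E C0E [X in const_ratmx D0 + X]tr.
  have -> : row_mx Kinv^T 0 *m col_mx 0 (- Kinv) = 0.
    by rewrite mul_row_col mulmx0 mul0mx addr0.
  have -> : row_mx Kinv^T 0 *m jordan2 R m3 *m col_mx 0 (- Kinv)
      = - (V3 *m Phi33i *m V3^T).
    rewrite mul_row_block !mulmx0 mulmx1 !addr0 mul_row_col.
    by rewrite mul0mx add0r mulmxN KK.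
  rewrite /const_ratmx map_mx0 map_mxN scalerN subr0 opprK -addrA.
  by congr (_ + _); rewrite addrC.
have [Fu _] := mulmx1_unit FG.
have real0 : descriptor_realization (invmx F) E0 A0 B0 C0^T D0.
  split; first by rewrite E0E A0E; exact: P0.
  by rewrite (invmx_eq FG) -G0.
split; first by split.
- by rewrite -unitfE -unitmxE.
- split=> // N' E' A' B' C' D' real'.
  have := real0; rewrite E0E A0E C0E => real0'.
  rewrite addnn -mul2n -[X in (2 * X)%N](rank_jordan2 R).
  apply: (weierstrass_realization_bound JJ rB _ _ _ real0' real').
  - rewrite trmxK Ainvskew; exact: reachable_opp.
  - by apply: reachable_jordan2; rewrite /row_free mxrank_opp.
  - rewrite tr_row_mx trmxK trmx0; exact: reachable_tr_jordan2.
- exists k, (m3 + m3)%N, 1%:M, Ainv, (jordan2 R m3); split.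
  + by rewrite trmx1 mulmx1.
  + by exists 2; rewrite expr2 -mulmxE.
  + by rewrite trmx1 mul1mx mulmx1.
  + by rewrite trmx1 mul1mx mulmx1.
by rewrite BABE AtE border_quadratic -M1iE.
Qed.
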